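(* Let $(\mathfrak{g},\pi_1,\pi_2)$ be a compatible $3$-Lie algebra. Then $(C^*(\mathfrak{g},\mathfrak{g}),[\cdot,\cdot]_{\mathrm{3Lie}},\mathrm{d}_{\pi_1},\mathrm{d}_{\pi_2})$ is a bidifferential graded Lie algebra, where $\mathrm{d}_{\pi_1}P=[\pi_1,P]_{\mathrm{3Lie}}$ and $\mathrm{d}_{\pi_2}P=[\pi_2,P]_{\mathrm{3Lie}}$ for all $P\in C^p(\mathfrak{g},\mathfrak{g})$. Moreover, for all $\tilde\pi_1,\tilde\pi_2\in\mathrm{Hom}(\wedge^3\mathfrak{g},\mathfrak{g})$, $(\mathfrak{g},\pi_1+\tilde\pi_1,\pi_2+\tilde\pi_2)$ is a compatible $3$-Lie algebra if and only if the pair $(\tilde\pi_1,\tilde\pi_2)$ is a Maurer-Cartan element of the bidifferential graded Lie algebra $(C^*(\mathfrak{g},\mathfrak{g}),[\cdot,\cdot]_{\mathrm{3Lie}},\mathrm{d}_{\pi_1},\mathrm{d}_{\pi_2})$.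
   Context: All vector spaces are finite-dimensional over an algebraically closed field $\mathbb{K}$ of characteristic $0$. A 3-Lie algebra is a vector space $\mathfrak{g}$ with a skew-symmetric trilinear map $[\cdot,\cdot,\cdot]:\wedge^3\mathfrak{g}\to\mathfrak{g}$ such that $[x_1,x_2,[x_3,x_4,x_5]]=[[x_1,x_2,x_3],x_4,x_5]+[x_3,[x_1,x_2,x_4],x_5]+[x_3,x_4,[x_1,x_2,x_5]]$ for all $x_i\in\mathfrak{g}$. A compatible 3-Lie algebra is a triple $(\mathfrak{g},[\cdot,\cdot,\cdot],\{\cdot,\cdot,\cdot\})$ where $[\cdot,\cdot,\cdot]$ and $\{\cdot,\cdot,\cdot\}$ are 3-Lie algebra structures on $\mathfrak{g}$ such that for all $x_1,\dots,x_5\in\mathfrak{g}$: $[x_1,x_2,\{x_3,x_4,x_5\}]+\{x_1,x_2,[x_3,x_4,x_5]\}=[\{x_1,x_2,x_3\},x_4,x_5]+\{[x_1,x_2,x_3],x_4,x_5\}+[x_3,\{x_1,x_2,x_4\},x_5]+\{x_3,[x_1,x_2,x_4],x_5\}+[x_3,x_4,\{x_1,x_2,x_5\}]+\{x_3,x_4,[x_1,x_2,x_5]\}$. The graded Lie algebra $(C^*(\mathfrak{g},\mathfrak{g}),[\cdot,\cdot]_{\mathrm{3Lie}})$: $C^*(\mathfrak{g},\mathfrak{g})=\oplus_{n\ge0}C^n(\mathfrak{g},\mathfrak{g})$, where $C^n(\mathfrak{g},\mathfrak{g})=\mathrm{Hom}(\underbrace{\wedge^2\mathfrak{g}\otimes\cdots\otimes\wedge^2\mathfrak{g}}_{n}\wedge\mathfrak{g},\mathfrak{g})$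 has degree $n$; here for $n\ge1$ the domain means $(\wedge^2\mathfrak{g})^{\otimes(n-1)}\otimes\wedge^3\mathfrak{g}$ (the last $\wedge^2\mathfrak{g}$ is wedged with $\mathfrak{g}$), and for $n=0$ it is $\mathfrak{g}$; so $C^0=\mathrm{Hom}(\mathfrak{g},\mathfrak{g})$, $C^1=\mathrm{Hom}(\wedge^3\mathfrak{g},\mathfrak{g})$. For $P\in C^p$, $Q\in C^q$, $[P,Q]_{\mathrm{3Lie}}=P\circ Q-(-1)^{pq}Q\circ P$, where, with $\mathfrak{X}_i=x_i\wedge y_i\in\wedge^2\mathfrak{g}$, $x\in\mathfrak{g}$, $$\begin{aligned}&(P\circ Q)(\mathfrak{X}_1,\dots,\mathfrak{X}_{p+q},x)\\=&\sum_{k=1}^p(-1)^{(k-1)q}\sum_{\sigma\in S(k-1,q)}(-1)^\sigma P\big(\mathfrak{X}_{\sigma(1)},\dots,\mathfrak{X}_{\sigma(k-1)},Q(\mathfrak{X}_{\sigma(k)},\dots,\mathfrak{X}_{\sigma(k+q-1)},x_{k+q})\wedge y_{k+q},\mathfrak{X}_{k+q+1},\dots,\mathfrak{X}_{p+q},x\big)\\&+\sum_{k=1}^p(-1)^{(k-1)q}\sum_{\sigma\in S(k-1,q)}(-1)^\sigma P\big(\mathfrak{X}_{\sigma(1)},\dots,\mathfrak{X}_{\sigma(k-1)},x_{k+q}\wedge Q(\mathfrak{X}_{\sigma(k)},\dots,\mathfrak{X}_{\sigma(k+q-1)},y_{k+q}),\mathfrak{X}_{k+q+1},\dots,\mathfrak{X}_{p+q},x\big)\\&+\sum_{\sigma\in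 S(p,q)}(-1)^{pq}(-1)^\sigma P\big(\mathfrak{X}_{\sigma(1)},\dots,\mathfrak{X}_{\sigma(p)},Q(\mathfrak{X}_{\sigma(p+1)},\dots,\mathfrak{X}_{\sigma(p+q)},x)\big),\end{aligned}$$ where $S(a,b)$ is the set of $(a,b)$-shuffles, i.e. permutations $\sigma$ of $\{1,\dots,a+b\}$ with $\sigma(1)<\dots<\sigma(a)$ and $\sigma(a+1)<\dots<\sigma(a+b)$. It is known that this is a graded Lie algebra. A bidifferential graded Lie algebra $(\mathcal{G},[\cdot,\cdot],\mathrm{d}_1,\mathrm{d}_2)$ consists of two differential graded Lie algebras $(\mathcal{G},[\cdot,\cdot],\mathrm{d}_1)$, $(\mathcal{G},[\cdot,\cdot],\mathrm{d}_2)$ on the same graded Lie algebra $\mathcal{G}=\oplus_{i\ge0}\mathfrak{g}_i$ with $\mathrm{d}_1\mathrm{d}_2+\mathrm{d}_2\mathrm{d}_1=0$. A Maurer-Cartan element of it is a pair $(P_1,P_2)\in\mathfrak{g}_1\oplus\mathfrak{g}_1$ with $\mathrm{d}_1P_1+\frac12[P_1,P_1]=0$, $\mathrm{d}_2P_2+\frac12[P_2,P_2]=0$ and $\mathrm{d}_1P_2+\mathrm{d}_2P_1+[P_1,P_2]=0$. *)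

(* Defs.v *)
From HB Require Import structures.
From mathcomp Require Import all_boot all_order all_algebra all_fingroup.
From mathcomp Require Import boolp functions zify.

Set Implicit Arguments.
Unset Strict Implicit.
Unset Printing Implicit Defensive.

Import GRing.Theory.
Local Open Scope ring_scope.

Section ThreeLie.
Variables (K : fieldType) (g : lmodType K).
Implicit Type b : g -> g -> g -> g.

Definition trilinear b : Prop :=
  [/\ forall y z, linear (fun x => b x y z),
      forall x z, linear (fun y => b x y z)
    & forall x y, linear (fun z => b x y z)].

(* The two transpositions generate the symmetric group on three letters. *)
Definition skew_symmetric3 b : Prop :=
  (forall x y z, b y x z = - b x y z) /\ (forall x y z, b x z y = - b x y z).

Definition fundamental_identity b : Prop :=
  forall x1 x2 x3 x4 x5,
    b x1 x2 (b x3 x4 x5) =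
      b (b x1 x2 x3) x4 x5 + b x3 (b x1 x2 x4) x5 + b x3 x4 (b x1 x2 x5).

Definition is_3Lie b : Prop :=
  [/\ trilinear b, skew_symmetric3 b & fundamental_identity b].

Definition is_compatible_3Lie b c : Prop :=
  [/\ is_3Lie b, is_3Lie c
    & forall x1 x2 x3 x4 x5,
        b x1 x2 (c x3 x4 x5) + c x1 x2 (b x3 x4 x5) =
          b (c x1 x2 x3) x4 x5 + c (b x1 x2 x3) x4 x5 +
          b x3 (c x1 x2 x4) x5 + c x3 (b x1 x2 x4) x5 +
          b x3 x4 (c x1 x2 x5) + c x3 x4 (b x1 x2 x5)].

End ThreeLie.

Section GradedLie.
Variable K : fieldType.

(* Transport of a homogeneous element along an equality of degrees. *)
Definition gcast (V : nat -> Type) m n (e : m = n) (x : V m) : V n :=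
  ecast i (V i) e x.

(* A graded vector space is given by its homogeneous components V n, n >= 0,
   and a bracket of degree 0 by its restrictions to them. *)
Variable V : nat -> lmodType K.
Variable br : forall p q : nat, V p -> V q -> V (p + q)%N.

Local Notation cast e x := (gcast (V := V) e x).

Definition is_graded_Lie : Prop :=
  [/\ forall p q (y : V q), linear (fun x : V p => br x y),
      forall p q (x : V p), linear (fun y : V q => br x y),
      forall p q (x : V p) (y : V q),
        br x y = - ((-1) ^+ (p * q)) *: cast (addnC q p) (br y x)
    & forall p q r (x : V p) (y : V q) (z : V r),
        br x (br y z) =
          cast (esym (addnA p q r)) (br (br x y) z) +
          (-1) ^+ (p * q) *: cast (addnCA q p r) (br y (br x z))].

Definition is_dgLie (d : forall n, V n -> V n.+1) : Prop :=
  [/\ is_graded_Lie,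
      forall n, linear (@d n),
      forall n (x : V n), d _ (d _ x) = 0
    & forall p q (x : V p) (y : V q),
        d _ (br x y) =
          (br (d _ x) y : V (p + q).+1) +
          (-1) ^+ p *: cast (addnS p q) (br x (d _ y))].

Definition is_bidgLie (d1 d2 : forall n, V n -> V n.+1) : Prop :=
  [/\ is_dgLie d1, is_dgLie d2
    & forall n (x : V n), d1 _ (d2 _ x) + d2 _ (d1 _ x) = 0].

Definition is_Maurer_Cartan (d1 d2 : forall n, V n -> V n.+1)
    (P1 P2 : V 1) : Prop :=
  [/\ d1 _ P1 + 2%:R^-1 *: (br P1 P1 : V 2) = 0,
      d2 _ P2 + 2%:R^-1 *: (br P2 P2 : V 2) = 0
    & d1 _ P2 + d2 _ P1 + (br P1 P2 : V 2) = 0].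

End GradedLie.

Section Cochains.
Variables (K : fieldType) (g : lmodType K).

Definition upd n (X : n.-tuple (g * g)) (i : 'I_n) (v : g * g) :
    n.-tuple (g * g) :=
  [tuple if j == i then v else tnth X j | j < n].

(* Bilinear alternating maps, i.e. linear maps on the exterior square. *)
Definition alt_bilinear (h : g -> g -> g) : Prop :=
  [/\ forall y, linear (fun x => h x y), forall x, linear (fun y => h x y)
    & forall x, h x x = 0].

(* A linear map on (/\^2 g)^{(x)(n-1)} (x) /\^3 g is a function of n pairs
   (x_i, y_i), standing for x_i /\ y_i, and of one more vector x, which is
   multilinear, alternating in each pair, and alternating in x_n, y_n, x; the
   last clause is void for n = 0. *)
Definition is_cochain n (f : n.-tuple (g * g) -> g -> g) : Prop :=
  [/\ forall X i x, alt_bilinear (fun u v => f (upd X i (u, v)) x),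
      forall X, linear (f X)
    & forall X (i : 'I_n), i.+1 = n ->
        f X (tnth X i).1 = 0 /\ f X (tnth X i).2 = 0].

Definition cochain_pred n : {pred n.-tuple (g * g) -> g -> g} :=
  fun f => `[< is_cochain f >].
Arguments cochain_pred : clear implicits.

Lemma linear_comb a (f h : g -> g) :
  linear f -> linear h -> linear (fun x => a *: f x + h x).
Proof.
move=> lf lh b u v; rewrite lf lh !scalerDr !scalerA mulrC -!addrA.
by congr (_ + _); rewrite addrCA.
Qed.

Lemma alt_bilinear_comb a h h' : alt_bilinear h -> alt_bilinear h' ->
  alt_bilinear (fun u v => a *: h u v + h' u v).
Proof.
move=> [l r z] [l' r' z']; split=> [y|x|x]; try exact: linear_comb.
by rewrite z z' scaler0 addr0.
Qed.

Lemma alt_bilinear0 : alt_bilinear (fun _ _ => 0).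
Proof. by split=> // x a u v; rewrite scaler0 addr0. Qed.

Lemma cochain_submod n : submod_closed (cochain_pred n).
Proof.
split=> [|a f h /asboolP[f1 f2 f3] /asboolP[h1 h2 h3]]; apply/asboolP.
  by split=> // *; [exact: alt_bilinear0 | move=> a u v; rewrite scaler0 addr0].
split=> [X i x|X|X i ni]; [exact: alt_bilinear_comb | exact: linear_comb |].
have [a1 a2] := f3 X i ni; have [b1 b2] := h3 X i ni.
by rewrite /= !fctE a1 a2 b1 b2 scaler0 addr0.
Qed.

HB.instance Definition _ n :=
  GRing.isSubmodClosed.Build K _ (cochain_pred n) (cochain_submod n).

Record cochain n := Cochain {
  cochain_fun :> n.-tuple (g * g) -> g -> g;
  _ : cochain_fun \in cochain_pred n
}.

HB.instance Definition _ n := [isSub of cochain n for @cochain_fun n].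
HB.instance Definition _ n := [Choice of cochain n by <:].
HB.instance Definition _ n := [SubChoice_isSubLmodule of cochain n by <:].


Lemma cochainP n (P : cochain n) : is_cochain P.
Proof. by apply/asboolP; case: P. Qed.

Section Composition.
Variables p q : nat.

Definition is_shuffle (a b : nat) (s : 'S_(a + b)) : bool :=
  [forall i : 'I_a, forall j : 'I_a,
     (i < j)%N ==> (s (lshift b i) < s (lshift b j))%N] &&
  [forall i : 'I_b, forall j : 'I_b,
     (i < j)%N ==> (s (rshift a i) < s (rshift a j))%N].

(* The X_(s(1)), ..., X_(s(k)), and the X_(s(k+1)), ..., X_(s(k+q)). *)
Definition left_args k (s : 'S_(k + q)) (X : seq (g * g)) : k.-tuple (g * g) :=
  [tuple X`_(s (lshift q i)) | i < k].

Definition right_args k (s : 'S_(k + q)) (X : seq (g * g)) :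
    q.-tuple (g * g) :=
  [tuple X`_(s (rshift k j)) | j < q].

(* The p arguments X_(s(1)), ..., X_(s(k)), v, X_(k+q+2), ..., X_(p+q), for
   X of size p + q and k < p. *)
Definition insert_args k (s : 'S_(k + q)) (X : seq (g * g)) (v : g * g) :
    p.-tuple (g * g) :=
  [tuple (left_args s X ++ v :: drop (k + q).+1 X)`_i | i < p].

(* P o Q, for X of size p + q; the sum over k is shifted to start at 0, and
   X`_(k + q) is (x_(k+q+1), y_(k+q+1)). *)
Definition circ (P : cochain p) (Q : cochain q) (X : seq (g * g)) (x : g) : g :=
  \sum_(k < p) (-1) ^+ (k * q) *:
    (\sum_(s : 'S_(k + q) | is_shuffle s) (-1) ^+ s *:
       P (insert_args s X
            (Q (right_args s X) (X`_(k + q)).1, (X`_(k + q)).2)) x) +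
  \sum_(k < p) (-1) ^+ (k * q) *:
    (\sum_(s : 'S_(k + q) | is_shuffle s) (-1) ^+ s *:
       P (insert_args s X
            ((X`_(k + q)).1, Q (right_args s X) (X`_(k + q)).2)) x) +
  \sum_(s : 'S_(p + q) | is_shuffle s)
     (-1) ^+ (p * q) *: ((-1) ^+ s *: P (left_args s X) (Q (right_args s X) x)).

End Composition.

Definition bracket_fun p q (P : cochain p) (Q : cochain q)
    (X : (p + q).-tuple (g * g)) (x : g) : g :=
  circ P Q X x - (-1) ^+ (p * q) *: circ Q P X x.

Section Closure.

Lemma tnth_upd n (X : n.-tuple (g * g)) i v j :
  tnth (upd X i v) j = if j == i then v else tnth X j.
Proof. by rewrite tnth_mktuple. Qed.

Lemma nth_upd n (X : n.-tuple (g * g)) (i : 'I_n) v j : (j < n)%N ->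
  (upd X i v)`_j = if j == i then v else X`_j.
Proof.
move=> jn; rewrite -[j]/(val (Ordinal jn)) -!tnth_nth tnth_upd.
by rewrite -val_eqE.
Qed.

Lemma upd_id n (X : n.-tuple (g * g)) i : upd X i (tnth X i) = X.
Proof. by apply: eq_from_tnth => j; rewrite tnth_upd; case: eqP => [->|]. Qed.

Lemma linear_fun0 (f : g -> g) : linear f -> f 0 = 0.
Proof. by move=> lf; have := lf (-1) 0 0; rewrite scaler0 addr0 scaleN1r addNr. Qed.

Lemma linear_funD (f : g -> g) x y : linear f -> f (x + y) = f x + f y.
Proof. by move=> lf; have := lf 1 x y; rewrite !scale1r. Qed.

Lemma alt_bilinear_eq (h h' : g -> g -> g) :
  (forall u v, h u v = h' u v) -> alt_bilinear h' -> alt_bilinear h.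
Proof. by move=> hh'; have -> : h = h' by apply/funext => u; exact/funext. Qed.

Lemma alt_bilinearDl h x y z : alt_bilinear h -> h (x + y) z = h x z + h y z.
Proof. by move=> [l _ _]; exact: (linear_funD x y (l z)). Qed.

Lemma alt_bilinearDr h x y z : alt_bilinear h -> h x (y + z) = h x y + h x z.
Proof. by move=> [_ r _]; exact: (linear_funD y z (r x)). Qed.

Lemma alt_bilinearN h x y : alt_bilinear h -> h x y + h y x = 0.
Proof.
move=> ah; have [_ _ z] := ah; have := z (x + y).
by rewrite (alt_bilinearDl _ _ _ ah) !(alt_bilinearDr _ _ _ ah) !z add0r addr0.
Qed.

Lemma alt_bilinearD h h' : alt_bilinear h -> alt_bilinear h' ->
  alt_bilinear (fun u v => h u v + h' u v).
Proof.
move=> a b; apply: alt_bilinear_eq (alt_bilinear_comb 1 a b) => u v.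
by rewrite scale1r.
Qed.

Lemma alt_bilinearZ a h : alt_bilinear h -> alt_bilinear (fun u v => a *: h u v).
Proof.
move=> ah; apply: alt_bilinear_eq (alt_bilinear_comb a ah alt_bilinear0) => u v.
by rewrite addr0.
Qed.

Lemma alt_bilinear_sum I (r : seq I) (Pr : pred I) (h : I -> g -> g -> g) :
  (forall i, Pr i -> alt_bilinear (h i)) ->
  alt_bilinear (fun u v => \sum_(i <- r | Pr i) h i u v).
Proof.
move=> ah; elim: r => [|i r IH].
  by apply: alt_bilinear_eq alt_bilinear0 => u v; rewrite big_nil.
case Pi: (Pr i).
  apply: alt_bilinear_eq (alt_bilinearD (ah i Pi) IH) => u v.
  by rewrite big_cons Pi.
by apply: alt_bilinear_eq IH => u v; rewrite big_cons Pi.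
Qed.

Lemma alt_bilinear_post (f : g -> g) h : linear f -> alt_bilinear h ->
  alt_bilinear (fun u v => f (h u v)).
Proof.
move=> lf [l r z]; split=> [y a u v|x a u v|x].
- by rewrite l lf.
- by rewrite r lf.
- by rewrite z linear_fun0.
Qed.

Lemma alt_bilinear_der (f : g -> g) h : linear f -> alt_bilinear h ->
  alt_bilinear (fun u v => h (f u) v + h u (f v)).
Proof.
move=> lf ah; have [l r z] := ah; split=> [y a u v|x a u v|x].
- by rewrite lf !l scalerDr !addrA; congr (_ + _); rewrite addrAC.
- by rewrite lf !r scalerDr !addrA; congr (_ + _); rewrite addrAC.
- exact: alt_bilinearN.
Qed.

Lemma linear_sum I (r : seq I) (Pr : pred I) (h : I -> g -> g) :
  (forall i, linear (h i)) -> linear (fun x => \sum_(i <- r | Pr i) h i x).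
Proof.
move=> lh a u v; rewrite scaler_sumr -big_split /=.
by apply: eq_bigr => i _; rewrite lh.
Qed.

Lemma linearZ_fun a (f : g -> g) : linear f -> linear (fun x => a *: f x).
Proof.
by move=> lf b u v; rewrite lf scalerDr !scalerA mulrC.
Qed.

Lemma linearD_fun (f h : g -> g) :
  linear f -> linear h -> linear (fun x => f x + h x).
Proof.
by move=> lf lh b u v; rewrite lf lh scalerDr !addrA; congr (_ + _); rewrite addrAC.
Qed.

Section Circ.
Variables (p q : nat) (P : cochain p) (Q : cochain q).

Definition circ_term k (s : 'S_(k + q)) (X : seq (g * g)) x : g :=
  P (insert_args p s X
       (Q (right_args s X) (X`_(k + q)).1, (X`_(k + q)).2)) x +
  P (insert_args p s X
       ((X`_(k + q)).1, Q (right_args s X) (X`_(k + q)).2)) x.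

Lemma circE X x : circ P Q X x =
  \sum_(k < p) (-1) ^+ (k * q) *:
    (\sum_(s : 'S_(k + q) | is_shuffle s) (-1) ^+ s *: circ_term s X x) +
  (-1) ^+ (p * q) *: \sum_(s : 'S_(p + q) | is_shuffle s)
     (-1) ^+ s *: P (left_args s X) (Q (right_args s X) x).
Proof.
rewrite /circ scaler_sumr; congr (_ + _); rewrite -big_split /=.
apply: eq_bigr => k _; rewrite -scalerDr -big_split /=; congr (_ *: _).
by apply: eq_bigr => s _; rewrite -scalerDr.
Qed.

Lemma tnth_insert_lt k (s : 'S_(k + q)) (X : seq (g * g)) v (i : 'I_p)
    (j : 'I_k) :
  i = j :> nat -> tnth (insert_args p s X v) i = X`_(s (lshift q j)).
Proof.
move=> ij; rewrite tnth_mktuple nth_cat size_tuple ij ltn_ord.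
by rewrite -tnth_nth tnth_mktuple.
Qed.

Lemma tnth_insert_eq k (s : 'S_(k + q)) (X : seq (g * g)) v (i : 'I_p) :
  i = k :> nat -> tnth (insert_args p s X v) i = v.
Proof. by move=> ij; rewrite tnth_mktuple nth_cat size_tuple ij ltnn subnn. Qed.

Lemma tnth_insert_gt k (s : 'S_(k + q)) (X : seq (g * g)) v (i : 'I_p) :
  (k < i)%N -> tnth (insert_args p s X v) i = X`_(i + q).
Proof.
move=> ki; rewrite tnth_mktuple nth_cat size_tuple ltnNge (ltnW ki) /=.
have -> : (i - k)%N = (i - k.+1).+1 by lia.
by rewrite /= nth_drop; congr nth; lia.
Qed.

Lemma insert_upd (k : 'I_p) (s : 'S_(k + q)) X v :
  insert_args p s X v = upd (insert_args p s X 0) k v.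
Proof.
apply: eq_from_tnth => i; rewrite tnth_upd; case: eqP => [->|/eqP].
  by rewrite tnth_insert_eq.
rewrite -val_eqE /= neq_ltn => /orP[ik|ki].
  by rewrite !(tnth_insert_lt s _ _ (j := Ordinal ik)).
by rewrite !tnth_insert_gt.
Qed.

Variable X : (p + q).-tuple (g * g).

Lemma right_args_upd k (s : 'S_(k + q)) (m : 'I_(p + q)) v : (k <= p)%N ->
  (forall j : 'I_q, s (rshift k j) != m :> nat) ->
  right_args s (upd X m v) = right_args s X.
Proof.
move=> kp sm; apply: eq_from_tnth => j; rewrite !tnth_mktuple nth_upd.
  by rewrite (negPf (sm j)).
by have := ltn_ord (s (rshift k j)); lia.
Qed.

Lemma left_args_upd k (s : 'S_(k + q)) (m : 'I_(p + q)) v : (k <= p)%N ->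
  (forall j : 'I_k, s (lshift q j) != m :> nat) ->
  left_args s (upd X m v) = left_args s X.
Proof.
move=> kp sm; apply: eq_from_tnth => j; rewrite !tnth_mktuple nth_upd.
  by rewrite (negPf (sm j)).
by have := ltn_ord (s (lshift q j)); lia.
Qed.

Lemma right_args_updE k (s : 'S_(k + q)) (m : 'I_(p + q)) j v : (k <= p)%N ->
  s (rshift k j) = m :> nat ->
  right_args s (upd X m v) = upd (right_args s X) j v.
Proof.
move=> kp sm; apply: eq_from_tnth => i; rewrite tnth_upd !tnth_mktuple nth_upd.
  by rewrite -sm (inj_eq val_inj) (inj_eq perm_inj) (inj_eq (@rshift_inj _ _)).
by have := ltn_ord (s (rshift k i)); lia.
Qed.

Lemma left_args_updE k (s : 'S_(k + q)) (m : 'I_(p + q)) j v : (k <= p)%N ->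
  s (lshift q j) = m :> nat ->
  left_args s (upd X m v) = upd (left_args s X) j v.
Proof.
move=> kp sm; apply: eq_from_tnth => i; rewrite tnth_upd !tnth_mktuple nth_upd.
  by rewrite -sm (inj_eq val_inj) (inj_eq perm_inj) (inj_eq (@lshift_inj _ _)).
by have := ltn_ord (s (lshift q i)); lia.
Qed.

Lemma insert_args_upd (k : 'I_p) (s : 'S_(k + q)) (m : 'I_(p + q)) v w :
  (m <= k + q)%N -> (forall j : 'I_k, s (lshift q j) != m :> nat) ->
  insert_args p s (upd X m v) w = insert_args p s X w.
Proof.
move=> mk sm; apply: eq_from_tnth => i; have kp := ltn_ord k; have ip := ltn_ord i.
have [ik|ki|ik] := ltngtP i k; last by rewrite !tnth_insert_eq.
  rewrite !(tnth_insert_lt s _ _ (j := Ordinal ik)) // nth_upd ?(negPf (sm _)) //.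
  by have := ltn_ord (s (lshift q (Ordinal ik))); lia.
rewrite !tnth_insert_gt // nth_upd; last by lia.
by case: eqP => //; lia.
Qed.

Lemma insert_args_updl (k : 'I_p) (s : 'S_(k + q)) (m : 'I_(p + q)) v w
    (j : 'I_k) :
  s (lshift q j) = m :> nat ->
  insert_args p s (upd X m v) w =
    upd (insert_args p s X w) (widen_ord (ltnW (ltn_ord k)) j) v.
Proof.
move=> sm; apply: eq_from_tnth => i; have kp := ltn_ord k; have ip := ltn_ord i.
have jk := ltn_ord j; have sj := ltn_ord (s (lshift q j)).
rewrite tnth_upd -val_eqE /=.
have [ik|ki|ik] := ltngtP i k.
- rewrite !(tnth_insert_lt s _ _ (j := Ordinal ik)) // nth_upd; last first.
    by have := ltn_ord (s (lshift q (Ordinal ik))); lia.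
  rewrite -sm (inj_eq val_inj) (inj_eq perm_inj) (inj_eq (@lshift_inj _ _)).
  by rewrite -val_eqE.
- rewrite !tnth_insert_gt // nth_upd; last by lia.
  by case: eqP; case: eqP => //; lia.
- by rewrite !tnth_insert_eq //; case: eqP => //; lia.
Qed.

Lemma insert_args_updr (k : 'I_p) (s : 'S_(k + q)) (m : 'I_(p + q)) v w
    (mp : (m - q < p)%N) :
  (k + q < m)%N ->
  insert_args p s (upd X m v) w = upd (insert_args p s X w) (Ordinal mp) v.
Proof.
move=> km; apply: eq_from_tnth => i; have kp := ltn_ord k; have ip := ltn_ord i.
rewrite tnth_upd -val_eqE /=.
have [ik|ki|ik] := ltngtP i k.
- have sj := ltn_ord (s (lshift q (Ordinal ik))).
  rewrite !(tnth_insert_lt s _ _ (j := Ordinal ik)) // nth_upd; last by lia.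
  by case: eqP; case: eqP => //; lia.
- rewrite !tnth_insert_gt // nth_upd; last by lia.
  by case: eqP; case: eqP => //; lia.
- by rewrite !tnth_insert_eq //; case: eqP => //; lia.
Qed.

Lemma circ_term_alt (k : 'I_p) (s : 'S_(k + q)) (m : 'I_(p + q)) x :
  alt_bilinear (fun u v => circ_term s (upd X m (u, v)) x).
Proof.
have [P1 P2 P3] := cochainP P; have [Q1 Q2 Q3] := cochainP Q.
have kp := ltn_ord k; have mpq := ltn_ord m; have kpW := ltnW kp.
have kqn : (k + q < p + q)%N by lia.
have sn (i : 'I_(k + q)) : s i != (k + q)%N :> nat.
  by have := ltn_ord (s i); lia.
have PE v : P (insert_args p s X v) x = P (upd (insert_args p s X 0) k v) x.
  by rewrite -insert_upd.
rewrite /circ_term.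
have [mk|km|mk] := ltngtP m (k + q)%N.
- have X0 u v : (upd X m (u, v))`_(k + q) = X`_(k + q).
    by rewrite nth_upd //; case: eqP => //; lia.
  eapply alt_bilinear_eq; [move=> u v|].
    rewrite !X0; reflexivity.
  have : exists i, s i = m :> nat by exists (s^-1 (Ordinal mk))%g; rewrite permKV.
  move=> [i]; case: (split_ordP i) => j ->{i} sm.
    have sr i : s (rshift k i) != m :> nat.
      rewrite -sm; apply/eqP => /val_inj/perm_inj/eqP.
      by rewrite eq_rlshift.
    eapply alt_bilinear_eq; [move=> u v|].
      rewrite (right_args_upd _ kpW sr)
        !(insert_args_updl _ _ sm); reflexivity.
    by apply: alt_bilinearD; exact: P1.
  have sl i : s (lshift q i) != m :> nat.
    rewrite -sm; apply/eqP => /val_inj/perm_inj/eqP.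
    by rewrite eq_lrshift.
  eapply alt_bilinear_eq; [move=> u v|].
    rewrite (right_args_updE _ kpW sm)
      !(insert_args_upd _ _ (ltnW mk) sl) !PE; reflexivity.
  apply: alt_bilinearD.
    have := alt_bilinear_post
      ((let: And3 l _ _ := P1 (insert_args p s X 0) k x in l) (X`_(k + q)).2)
      (Q1 (right_args s X) j (X`_(k + q)).1).
    by [].
  have := alt_bilinear_post
    ((let: And3 _ r _ := P1 (insert_args p s X 0) k x in r) (X`_(k + q)).1)
    (Q1 (right_args s X) j (X`_(k + q)).2).
  by [].
- have X0 u v : (upd X m (u, v))`_(k + q) = X`_(k + q).
    by rewrite nth_upd //; case: eqP => //; lia.
  have mp : (m - q < p)%N by lia.
  have sr i : s (rshift k i) != m :> nat by have := ltn_ord (s (rshift k i)); lia.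
  eapply alt_bilinear_eq; [move=> u v|].
    rewrite !X0 (right_args_upd _ kpW sr)
      !(insert_args_updr s _ _ mp km); reflexivity.
  by apply: alt_bilinearD; exact: P1.
have X0 u v : (upd X m (u, v))`_(k + q) = (u, v) by rewrite nth_upd // mk eqxx.
have sm i : s i != m :> nat by rewrite mk.
have mk' : (m <= k + q)%N by rewrite mk.
eapply alt_bilinear_eq; [move=> u v|].
  rewrite !X0 /= (right_args_upd _ kpW (fun j => sm _))
    !(insert_args_upd _ _ mk' (fun j => sm _)) !PE; reflexivity.
exact: (alt_bilinear_der (Q2 (right_args s X)) (P1 (insert_args p s X 0) k x)).
Qed.

Lemma circ_last_alt (s : 'S_(p + q)) (m : 'I_(p + q)) x :
  alt_bilinear (fun u v =>
    P (left_args s (upd X m (u, v))) (Q (right_args s (upd X m (u, v))) x)).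
Proof.
have [P1 P2 P3] := cochainP P; have [Q1 Q2 Q3] := cochainP Q.
have : exists i, s i = m by exists (s^-1 m)%g; rewrite permKV.
move=> [i]; case: (split_ordP i) => j ->{i} /(congr1 val) sm.
  have sr i : s (rshift p i) != m :> nat.
    rewrite -sm; apply/eqP => /val_inj/perm_inj/eqP.
    by rewrite eq_rlshift.
  eapply alt_bilinear_eq; [move=> u v|].
    rewrite (right_args_upd _ (leqnn p) sr) (left_args_updE _ (leqnn p) sm); reflexivity.
  exact: P1.
have sl i : s (lshift q i) != m :> nat.
  rewrite -sm; apply/eqP => /val_inj/perm_inj/eqP.
  by rewrite eq_lrshift.
eapply alt_bilinear_eq; [move=> u v|].
  rewrite (left_args_upd _ (leqnn p) sl) (right_args_updE _ (leqnn p) sm); reflexivity.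
exact: (alt_bilinear_post (P2 _) (Q1 _ _ _)).
Qed.

Lemma circ_alt (m : 'I_(p + q)) x :
  alt_bilinear (fun u v => circ P Q (upd X m (u, v)) x).
Proof.
eapply alt_bilinear_eq; [move=> u v|].
  rewrite circE; reflexivity.
apply: alt_bilinearD.
  apply: alt_bilinear_sum => k _; apply: alt_bilinearZ.
  apply: alt_bilinear_sum => s _; apply: alt_bilinearZ.
  exact: circ_term_alt.
apply: alt_bilinearZ; apply: alt_bilinear_sum => s _; apply: alt_bilinearZ.
exact: circ_last_alt.
Qed.

Lemma circ_linear : linear (circ P Q X).
Proof.
have [P1 P2 P3] := cochainP P; have [Q1 Q2 Q3] := cochainP Q.
have -> : circ P Q X = fun x => circ P Q X x by [].
under eq_fun do rewrite circE.
apply: linearD_fun.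
  apply: linear_sum => k; apply: linearZ_fun; apply: linear_sum => s.
  by apply: linearZ_fun; apply: linearD_fun; exact: P2.
apply: linearZ_fun; apply: linear_sum => s; apply: linearZ_fun => a u v.
by rewrite Q2 P2.
Qed.

End Circ.

Lemma cochain_swap n (P : cochain n) T (k : 'I_n) a b c : k.+1 = n ->
  P (upd T k (a, c)) b + P (upd T k (b, c)) a = 0 /\
  P (upd T k (c, a)) b + P (upd T k (c, b)) a = 0.
Proof.
move=> kn; have [P1 P2 P3] := cochainP P.
have z u v : P (upd T k (u, v)) u = 0 /\ P (upd T k (u, v)) v = 0.
  by have [] := P3 (upd T k (u, v)) k kn; rewrite tnth_upd eqxx.
have z1 u v := proj1 (z u v); have z2 u v := proj2 (z u v).
split.
  have := z1 (a + b) c.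
  rewrite (alt_bilinearDl a b c (P1 T k (a + b))) !(linear_funD _ _ (P2 _)).
  by rewrite !z1 add0r addr0.
have := z2 c (a + b).
rewrite (alt_bilinearDr c a b (P1 T k (a + b))) !(linear_funD _ _ (P2 _)).
by rewrite !z2 add0r addr0.
Qed.

Lemma shuffle_lastl a b (s : 'S_(a + b)) (j : 'I_a) :
  is_shuffle s -> (s (lshift b j)).+1 = (a + b)%N -> j.+1 = a.
Proof.
case/andP=> /'forall_forallP sl _ sj; apply/eqP; rewrite eqn_leq ltn_ord leqNgt.
apply/negP => ja; have := sl j (Ordinal ja); rewrite ltnSn /=.
by have := ltn_ord (s (lshift b (Ordinal ja))); lia.
Qed.

Lemma shuffle_lastr a b (s : 'S_(a + b)) (j : 'I_b) :
  is_shuffle s -> (s (rshift a j)).+1 = (a + b)%N -> j.+1 = b.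
Proof.
case/andP=> _ /'forall_forallP sr sj; apply/eqP; rewrite eqn_leq ltn_ord leqNgt.
apply/negP => jb; have := sr j (Ordinal jb); rewrite ltnSn /=.
by have := ltn_ord (s (rshift a (Ordinal jb))); lia.
Qed.

Lemma reindex_lift_perm n (i0 j0 : 'I_n.+1) (Pr : pred 'S_n.+1)
    (F : 'S_n.+1 -> g) :
  \sum_(s : 'S_n.+1 | Pr s && (s i0 == j0)) F s =
  \sum_(s : 'S_n | Pr (lift_perm i0 j0 s)) F (lift_perm i0 j0 s).
Proof.
rewrite (reindex (lift_perm i0 j0)); last first.
  pose ulsf i (s : 'S_n.+1) k := odflt k (unlift (s i) (s (lift i k))).
  have ulsfK i (s : 'S_n.+1) k: lift (s i) (ulsf i s k) = s (lift i k).
    rewrite /ulsf; have:= neq_lift i k.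
    by rewrite -(can_eq (permK s)) => /unlift_some[] ? ? ->.
  have inj_ulsf: injective (ulsf i0 _).
    move=> s; apply: can_inj (ulsf (s i0) s^-1%g) _ => k'.
    by rewrite {1}/ulsf ulsfK !permK liftK.
  exists (fun s => perm (inj_ulsf s)) => [s _ | s].
    by apply/permP=> k'; rewrite permE /ulsf lift_perm_lift lift_perm_id liftK.
  move/andP=> [_] /(s _ =P _) si0; apply/permP=> k.
  case: (unliftP i0 k) => [k'|] ->; rewrite ?lift_perm_id //.
  by rewrite lift_perm_lift -si0 permE ulsfK.
by apply: eq_bigl => s; rewrite lift_perm_id eqxx andbT.
Qed.

Lemma circ_vanish0 q (P : cochain 0) (Q : cochain q)
    (X : (0 + q).-tuple (g * g)) (m : 'I_(0 + q)) z :
  m.+1 = (0 + q)%N -> z = (tnth X m).1 \/ z = (tnth X m).2 -> circ P Q X z = 0.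
Proof.
have [P1 P2 P3] := cochainP P; have [Q1 Q2 Q3] := cochainP Q.
move=> mE zE; rewrite circE big_ord0 add0r big1 ?scaler0 // => s ss.
have : exists i, s i = m by exists (s^-1 m)%g; rewrite permKV.
move=> [i]; case: (split_ordP i) => [[]//|j ->{i} sm].
have jq : j.+1 = q by apply: (shuffle_lastr ss); rewrite sm.
have [] := Q3 (right_args s X) j jq.
rewrite tnth_mktuple sm -tnth_nth => Qu Qv.
suff -> : Q (right_args s X) z = 0 by rewrite (linear_fun0 (P2 _)) scaler0.
by case: zE => ->.
Qed.

Lemma circ_vanishS p q (P : cochain p.+1) (Q : cochain q)
    (X : (p.+1 + q).-tuple (g * g)) (m : 'I_(p.+1 + q)) z :
  m.+1 = (p.+1 + q)%N -> z = (tnth X m).1 \/ z = (tnth X m).2 ->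
  circ P Q X z = 0.
Proof.
have [P1 P2 P3] := cochainP P; have [Q1 Q2 Q3] := cochainP Q.
move=> mE zE; rewrite circE big_ord_recr /=.
have mpq : m = (p + q)%N :> nat by lia.
have Xm : X`_(p + q) = tnth X m by rewrite (tnth_nth 0) mpq.
rewrite big1 ?add0r; last first.
  move=> k _; rewrite big1 ?scaler0 // => s _; rewrite /circ_term.
  have V v : P (insert_args p.+1 s X v) z = 0.
    have [] := P3 (insert_args p.+1 s X v) ord_max erefl.
    rewrite tnth_insert_gt /= ?Xm // => Pu Pv.
    by case: zE => ->.
  by rewrite !V addr0 scaler0.
pose i0 : 'I_(p + q).+1 := lshift q (ord_max : 'I_p.+1).
rewrite [X in _ + _ *: X](bigID (fun s : 'S_(p.+1 + q) => s i0 == m)) /=.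
rewrite [X in _ + _ *: (_ + X)]big1 ?addr0; last first.
  move=> s /andP[ss si0].
  have : exists i, s i = m by exists (s^-1 m)%g; rewrite permKV.
  move=> [i]; case: (split_ordP i) => j ->{i} sm.
    have jp : j.+1 = p.+1 by apply: (shuffle_lastl ss); rewrite sm.
    case/eqP: si0; rewrite -sm; congr (s _); apply: val_inj.
    by case: jp => /= ->.
  have jq : j.+1 = q by apply: (shuffle_lastr ss); rewrite sm.
  have [] := Q3 (right_args s X) j jq.
  rewrite tnth_mktuple sm -tnth_nth => Qu Qv.
  suff -> : Q (right_args s X) z = 0 by rewrite (linear_fun0 (P2 _)) scaler0.
  by case: zE => ->.
have mmax : m = (ord_max : 'I_(p + q).+1) by apply: val_inj.
rewrite (@reindex_lift_perm (p + q) i0 m).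
have Ll (s : 'S_(p + q)) i : lift_perm i0 m s (lift i0 i) = s i :> nat.
  by rewrite lift_perm_lift mmax lift_max.
have ll (i : 'I_p) : lshift q (widen_ord (leqnSn p) i) =
    lift i0 (lshift q i) :> 'I_(p.+1 + q).
  by apply: val_inj; rewrite /= /bump leqNgt ltn_ord.
have lr (i : 'I_q) : rshift p.+1 i = lift i0 (rshift p i) :> 'I_(p.+1 + q).
  by apply: val_inj; rewrite /= /bump leq_addr.
have Li (s : 'S_(p + q)) : lift_perm i0 m s i0 = m by rewrite lift_perm_id.
rewrite [X in _ + _ *: X](eq_bigl (fun s : 'S_(p + q) => is_shuffle s)); last first.
  move=> s; rewrite /is_shuffle; congr (_ && _); last first.
    apply/idP/idP => /'forall_forallP H; apply/'forall_forallP => i j; have := H i j.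
      by rewrite !lr !Ll.
    by rewrite !lr !Ll.
  apply/idP/idP => /'forall_forallP H; apply/'forall_forallP => i j.
    have := H (widen_ord (leqnSn p) i) (widen_ord (leqnSn p) j).
    by rewrite !ll !Ll.
  apply/implyP => ij.
  have ip : (i < p)%N by have := ltn_ord j; lia.
  have -> : i = widen_ord (leqnSn p) (Ordinal ip) by apply: val_inj.
  rewrite ll Ll.
  have [jp|jp] := ltnP j p.
    have -> : j = widen_ord (leqnSn p) (Ordinal jp) by apply: val_inj.
    by rewrite ll Ll; apply: (implyP (H (Ordinal ip) (Ordinal jp))).
  have -> : j = ord_max by apply: val_inj; have := ltn_ord j; rewrite /=; lia.
  by rewrite Li mpq.
rewrite !scaler_sumr -big_split big1 //= => s _.
pose T := insert_args p.+1 s X 0.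
have -> : left_args (q := q) (k := p.+1) (lift_perm i0 m s) X =
    upd T (ord_max : 'I_p.+1) (tnth X m).
  apply: eq_from_tnth => i; rewrite tnth_upd tnth_mktuple.
  case: eqP => [->|/eqP ni]; first by rewrite Li (tnth_nth 0).
  have ip : (i < p)%N by move: ni; rewrite -val_eqE /=; have := ltn_ord i; lia.
  rewrite (tnth_insert_lt s _ _ (j := Ordinal ip)) // -(Ll s) -ll.
  by congr (X`_(lift_perm i0 m s _)); apply: val_inj.
have -> : right_args (q := q) (k := p.+1) (lift_perm i0 m s) X = right_args s X.
  by apply: eq_from_tnth => i; rewrite !tnth_mktuple lr Ll.
have PE v : P (insert_args p.+1 s X v) z = P (upd T ord_max v) z.
  by rewrite -(insert_upd (k := (ord_max : 'I_p.+1))).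
rewrite /circ_term !PE Xm.
set a := right_args s X; case: (tnth X m) zE => u v /= zE.
rewrite odd_lift_perm /= mpq.
have -> : P (upd T ord_max (Q a u, v)) z + P (upd T ord_max (u, Q a v)) z =
    - P (upd T ord_max (u, v)) (Q a z).
  have van w1 w2 : P (upd T ord_max (w1, w2)) w1 = 0 /\
      P (upd T ord_max (w1, w2)) w2 = 0.
    by have [] := P3 (upd T ord_max (w1, w2)) ord_max erefl; rewrite tnth_upd eqxx.
  case: zE => ->.
    rewrite (proj1 (van _ _)) addr0; apply/eqP; rewrite -addr_eq0; apply/eqP.
    by have [] := cochain_swap P T (Q a u) u v (erefl : (ord_max : 'I_p.+1).+1 = p.+1).
  rewrite (proj2 (van _ _)) add0r; apply/eqP; rewrite -addr_eq0; apply/eqP.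
  by have [] := cochain_swap P T (Q a v) v u (erefl : (ord_max : 'I_p.+1).+1 = p.+1).
rewrite !scalerN !scalerA -scaleNr -scalerDl.
suff -> : - ((-1) ^+ (p * q) * (-1) ^+ s) +
    (-1) ^+ (p.+1 * q) * (-1) ^+ (odd p (+) odd (p + q) (+) s) = 0 :> K.
  by rewrite scale0r.
rewrite oddD addKb signr_addb signr_odd mulSn exprD.
by rewrite -mulrA mulrCA signrMK addNr.
Qed.

Lemma circ_vanish p q (P : cochain p) (Q : cochain q)
    (X : (p + q).-tuple (g * g)) (m : 'I_(p + q)) : m.+1 = (p + q)%N ->
  circ P Q X (tnth X m).1 = 0 /\ circ P Q X (tnth X m).2 = 0.
Proof.
case: p P X m => [|p] P X m mE; split.
- by apply: circ_vanish0 mE _; left.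
- by apply: circ_vanish0 mE _; right.
- by apply: circ_vanishS mE _; left.
- by apply: circ_vanishS mE _; right.
Qed.

Lemma circ_cochain p q (P : cochain p) (Q : cochain q) :
  is_cochain (fun X : (p + q).-tuple (g * g) => circ P Q X).
Proof.
split=> [X i x|X|X i]; [exact: circ_alt | exact: circ_linear | exact: circ_vanish].
Qed.

End Closure.

Lemma bracket_subproof p q (P : cochain p) (Q : cochain q) :
  bracket_fun P Q \in cochain_pred (p + q).
Proof.
have circQP : is_cochain (fun X : (p + q).-tuple (g * g) => circ Q P X).
  have := circ_cochain Q P.
  by case: _ / (addnC q p : (q + p)%N = (p + q)%N).
rewrite (_ : bracket_fun P Q = (fun X : (p + q).-tuple (g * g) => circ P Q X) -
  (-1) ^+ (p * q) *: (fun X : (p + q).-tuple (g * g) => circ Q P X)) //.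
by apply: rpredB; [|apply: rpredZ]; apply/asboolP => //; exact: circ_cochain.
Qed.

Definition bracket p q (P : cochain p) (Q : cochain q) : cochain (p + q) :=
  Cochain (bracket_subproof P Q).

Definition differential (pi : cochain 1) n (P : cochain n) : cochain n.+1 :=
  bracket pi P.

(* The 3-ary operation of an element of C^1 = Hom(/\^3 g, g); by the lemmas
   below, op3 is a bijection onto the skew-symmetric trilinear operations. *)
Definition op3 (pi : cochain 1) (x y z : g) : g := pi [tuple (x, y)] z.

Lemma upd1 (X : 1.-tuple (g * g)) v : upd X ord0 v = [tuple v].
Proof.
by apply: eq_from_tnth => j; rewrite tnth_upd (ord1 j) eqxx tnth0.
Qed.

Lemma op3_trilinear pi : trilinear (op3 pi).
Proof.
have [P1 P2 _] := cochainP pi.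
have P1' z : alt_bilinear (fun u v => op3 pi u v z).
  by apply: alt_bilinear_eq (P1 [tuple 0] ord0 z) => u v; rewrite upd1.
split=> [y z|x z|x y]; [have [l _ _] := P1' z; exact: l| |exact: P2].
by have [_ r _] := P1' z; exact: r.
Qed.

Lemma op3_skew pi : skew_symmetric3 (op3 pi).
Proof.
have [P1 P2 P3] := cochainP pi; rewrite /op3.
split=> x y z; apply/eqP; rewrite -addr_eq0; apply/eqP.
  by have := alt_bilinearN y x (P1 [tuple 0] ord0 z); rewrite !upd1.
have [_] := cochain_swap pi [tuple 0] z y x (erefl : (ord0 : 'I_1).+1 = 1%N).
by rewrite !upd1.
Qed.

Lemma op3_bij b : 2%:R != 0 :> K -> trilinear b -> skew_symmetric3 b ->
  exists! pi, op3 pi = b.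
Proof.
move=> two [l1 l2 l3] [s1 s2].
have half (x : g) : x = - x -> x = 0.
  move/eqP; rewrite -addr_eq0 -mulr2n -scaler_nat scaler_eq0 (negPf two).
  by move/eqP.
have z1 x z : b x x z = 0 by apply: half; rewrite -s1.
have z2 x y : b x y y = 0 by apply: half; rewrite -s2.
have z3 x y : b x y x = 0 by rewrite s2 z1 oppr0.
pose f (X : 1.-tuple (g * g)) x := b (thead X).1 (thead X).2 x.
have fc : f \in cochain_pred 1.
  apply/asboolP; split=> [X i x|X|X i _]; rewrite /f.
  - rewrite (ord1 i); split=> [y|y|y].
    + by move=> a u v; rewrite !upd1 !theadE /= l1.
    + by move=> a u v; rewrite !upd1 !theadE /= l2.
    + by rewrite !upd1 theadE z1.
  - exact: l3.
  - by rewrite (ord1 i) -/(thead X) z3 z2.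
exists (Cochain fc); split; first by apply/funext => x; apply/funext => y.
move=> pi pib; apply: val_inj; apply/funext => X; apply/funext => x /=.
rewrite /f -pib /op3 -surjective_pairing; congr (pi _ x).
by apply: eq_from_tnth => j; rewrite (ord1 j) tnth0.
Qed.

End Cochains.

(* Main.v *)
Require Import Defs.
From mathcomp Require Import all_boot all_order all_algebra all_fingroup.
From mathcomp Require Import boolp functions zify.

Set Implicit Arguments.
Unset Strict Implicit.
Unset Printing Implicit Defensive.

Import GRing.Theory.
Local Open Scope ring_scope.

(** The theorem is formal once the bracket of cochains is known to be graded
    Lie and [b, c] = 0, for b and c in C^1, is known to be the compatibility
    condition of the two ternary operations ([bracket_eq0_compatible];
    for b = c and 2 invertible this is the fundamental identity).  Indeed
    d_b = [b, -] is then a derivation by the Jacobi identity, and the Jacobi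
    identity for b, c of degree 1 reads d_b d_c + d_c d_b = d_[b, c], which
    gives both d_b d_b = 0, as 2 is invertible, and the anticommutation of the
    differentials.  The Maurer-Cartan equations are the expansions of
    [b + t, b + t] = 0, [c + u, c + u] = 0 and [b + t, c + u] = 0, using
    [b, b] = [c, c] = [b, c] = 0.

    The work is in the graded Jacobi identity.  It follows from the graded
    pre-Lie identity of the composition P o Q: the associator
    (P o Q) o R - P o (Q o R) is graded symmetric in Q and R
    ([associator_sym]).  To prove that without nested shuffles, write i_X P for
    the cochain P with its first pair fixed to X = (x, y).  The first pair of
    P o Q is fed either to P or to Q, so that
      i_X (P o Q) = (-1)^q (i_X P) o Q + P o (i_X Q)         if q > 0,
      i_X (P o Q) = (i_X P) o Q + i_(Qx, y) P + i_(x, Qy) P  if q = 0,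
    where i_X P = 0 if P has degree 0.  These formulas determine P o Q, and are
    taken as the definition of a composition [insertion] of arbitrary functions
    of lists of pairs; [circ_insertion] identifies it with the sum over
    shuffles, by splitting shuffles according to the block that contains the
    first pair ([shuffle_sum_cons]).  Applied to an associator the formulas
    yield associators of contracted arguments, plus terms that are visibly
    symmetric in Q and R, and the pre-Lie identity follows by induction on the
    number of pairs.

    Working with functions of lists removes the casts between degrees:
    a cochain is extended by zero to the lists of the wrong length
    ([extend0]), which is injective and blind to [gcast]. *)

(** * Sums over shuffles *)

Section Shuffles.
Variables (K : fieldType) (g : lmodType K).
Implicit Types (T : seq (g * g)) (F : seq (g * g) -> seq (g * g) -> g).

(** The (a, n - a)-shuffles as permutations of 'I_n: with n independent of a,
    both halves of [shuffle_sum_cons] live in the same symmetric group, with no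
    cast between a + b.+1 and a.+1 + b. *)
Definition block_increasing n a (s : 'S_n) : bool :=
  [forall i : 'I_n, forall j : 'I_n,
     (i < j)%N && ((j < a)%N || (a <= i)%N) ==> (s i < s j)%N].

Lemma block_increasingP n a (s : 'S_n) :
  reflect (forall i j : 'I_n, (i < j)%N -> (j < a)%N || (a <= i)%N -> (s i < s j)%N)
          (block_increasing a s).
Proof.
apply: (iffP 'forall_forallP) => H i j; last by apply/implyP => /andP[]; exact: H.
by move=> ij ija; apply: (implyP (H i j)); rewrite ij.
Qed.

Lemma is_shuffleE a b (s : 'S_(a + b)) : is_shuffle s = block_increasing a s.
Proof.
apply/andP/block_increasingP => [[/'forall_forallP sl /'forall_forallP sr] i j|H].
  case: (split_ordP i) => i' ->; case: (split_ordP j) => j' -> /= ij ija.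
  - exact: (implyP (sl i' j')).
  - by have := ltn_ord i'; lia.
  - by have := ltn_ord j'; lia.
  - by apply: (implyP (sr i' j')); lia.
split; apply/'forall_forallP => i j; apply/implyP => ij; apply: H => /=.
- by [].
- by rewrite ltn_ord.
- by lia.
- by rewrite leq_addr orbT.
Qed.

Definition perm_args n (s : 'S_n) T := [seq T`_(s i) | i <- enum 'I_n].

Lemma size_perm_args n (s : 'S_n) T : size (perm_args s T) = n.
Proof. by rewrite size_map size_enum_ord. Qed.

Lemma nth_perm_args n (s : 'S_n) T (i : 'I_n) : (perm_args s T)`_i = T`_(s i).
Proof. by rewrite (nth_map i) ?size_enum_ord // nth_ord_enum. Qed.

Lemma left_argsE a b (s : 'S_(a + b)) T :
  left_args s T = take a (perm_args s T) :> seq _.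
Proof.
apply: (@eq_from_nth _ 0); rewrite size_tuple ?size_takel ?size_perm_args ?leq_addr //.
move=> i ia; rewrite nth_take //.
have /= <- := tnth_nth 0 (left_args s T) (Ordinal ia).
by rewrite tnth_mktuple -(nth_perm_args s T (lshift b (Ordinal ia))).
Qed.

Lemma right_argsE a b (s : 'S_(a + b)) T :
  right_args s T = drop a (perm_args s T) :> seq _.
Proof.
apply: (@eq_from_nth _ 0); rewrite size_tuple ?size_drop ?size_perm_args ?addKn //.
move=> i ib; rewrite nth_drop.
have /= <- := tnth_nth 0 (right_args s T) (Ordinal ib).
by rewrite tnth_mktuple -(nth_perm_args s T (rshift a (Ordinal ib))).
Qed.

(** A permutation that takes the value 0 at i0 inserts the head of the list at
    position i0 of the arrangement of its tail. *)
Lemma perm_args_lift n (i0 : 'I_n.+1) (s : 'S_n) X T :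
  perm_args (lift_perm i0 ord0 s) (X :: T) =
  take i0 (perm_args s T) ++ X :: drop i0 (perm_args s T).
Proof.
have i0n : (i0 <= n)%N by rewrite -ltnS.
apply: (@eq_from_nth _ 0).
  by rewrite size_cat /= size_drop size_takel !size_perm_args // addnS subnKC.
rewrite size_perm_args => i ilt; rewrite -[i]/(val (Ordinal ilt)).
rewrite nth_perm_args nth_cat size_takel ?size_perm_args //.
case: (unliftP i0 (Ordinal ilt)) => [k|] ->; last first.
  by rewrite lift_perm_id /= ltnn subnn.
rewrite lift_perm_lift /= /bump.
case: (leqP i0 k) => ik.
  rewrite ltnNge leqW //= subSn //= nth_drop subnKC //.
  by rewrite nth_perm_args.
by rewrite add0n ik nth_take // nth_perm_args.
Qed.

(** When i0 opens one of the two blocks, taking the value 0 there is no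
    constraint on the rest; the first block shrinks if i0 belongs to it. *)
Lemma block_increasing_lift n a c (i0 : 'I_n.+1) (s : 'S_n) :
  (i0 = 0%N :> nat /\ a = c.+1) \/ (i0 = a :> nat /\ a = c) ->
  block_increasing a (lift_perm i0 ord0 s) = block_increasing c s.
Proof.
move=> i0E; apply/block_increasingP/block_increasingP => H i j.
  move=> ij ijc; have := H (lift i0 i) (lift i0 j).
  rewrite !lift_perm_lift /= /bump => H'.
  have : (1 + s i < 1 + s j)%N by apply: H'; case: i0E => [][]; lia.
  by lia.
case: (unliftP i0 i) => [i'|] ->; case: (unliftP i0 j) => [j'|] ->;
  rewrite ?lift_perm_lift ?lift_perm_id /= /bump //.
- move=> ij ija; have : (s i' < s j')%N by apply: H; case: i0E => [][]; lia.
  by lia.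
- by case: i0E => [][]; lia.
- by rewrite ltnn.
Qed.

Definition shuffle_sum n a F T : g :=
  \sum_(s : 'S_n | block_increasing a s)
     (-1) ^+ s *: F (take a (perm_args s T)) (drop a (perm_args s T)).

Lemma shuffle_sum0 F T : shuffle_sum 0 0 F T = F [::] [::].
Proof.
have E (s : 'S_0) : s = 1%g by apply/permP => [[]].
rewrite /shuffle_sum (big_pred1 1%g).
  rewrite odd_perm1 scale1r.
  by rewrite (size0nil (size_perm_args 1%g T)).
by move=> s; rewrite (E s) /= eqxx; apply/block_increasingP => [[]].
Qed.

(** The value 0 of a shuffle is attained at the start of a block: at 0, or at a
    and then with the sign of the cycle that brings position a to the front. *)
Lemma shuffle_sum_cons n a F X T : (a <= n.+1)%N ->
  shuffle_sum n.+1 a F (X :: T) =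
    (if a is a'.+1 then shuffle_sum n a' (fun l => F (X :: l)) T else 0) +
    (if (a <= n)%N then (-1) ^+ a *: shuffle_sum n a (fun l r => F l (X :: r)) T
     else 0).
Proof.
move=> an.
have right_part (i0 : 'I_n.+1) : i0 = a :> nat ->
    \sum_(s : 'S_n.+1 | block_increasing a s && (s i0 == ord0)) (-1) ^+ s *:
      F (take a (perm_args s (X :: T))) (drop a (perm_args s (X :: T))) =
    (-1) ^+ a *: shuffle_sum n a (fun l r => F l (X :: r)) T.
  move=> i0a; rewrite reindex_lift_perm /shuffle_sum scaler_sumr.
  apply: eq_big => s; first by apply: block_increasing_lift; right.
  move=> _; rewrite scalerA odd_lift_perm addbF perm_args_lift i0a.
  rewrite take_size_cat ?drop_size_cat ?size_takel ?size_perm_args -?i0a -1?ltnS //.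
  by rewrite signr_addb signr_odd.
(* A value at an earlier position of the same block would be below 0. *)
have first_hit (s : 'S_n.+1) : block_increasing a s ->
    exists2 i : 'I_n.+1, s i = ord0 & i = 0%N :> nat \/ i = a :> nat.
  move/block_increasingP=> H; exists (s^-1 ord0)%g; first by rewrite permKV.
  set i := (s^-1 ord0)%g; have si : s i = ord0 by rewrite permKV.
  have [ia|ia] := ltnP i a.
    left; apply/eqP; rewrite -leqn0 leqNgt; apply/negP => i_gt0.
    by have := H ord0 i i_gt0; rewrite ia si => /(_ isT).
  right; apply/eqP; rewrite eqn_leq ia andbT leqNgt; apply/negP => a_lt.
  have an' : (a < n.+1)%N by exact: ltn_trans a_lt (ltn_ord i).
  by have := H (Ordinal an') i a_lt; rewrite leqnn orbT si => /(_ isT).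
case: a an right_part first_hit => [|a] an right_part first_hit.
  rewrite leq0n add0r -(right_part ord0) //; apply: eq_bigl => s.
  case sa: (block_increasing 0 s) => //=; apply/esym/eqP.
  by have [i si [] i0] := first_hit s sa; rewrite -[RHS]si; congr (s _); apply: val_inj.
rewrite {1}/shuffle_sum (bigID (fun s : 'S_n.+1 => s ord0 == ord0)) /=; congr (_ + _).
  rewrite reindex_lift_perm; apply: eq_big => s.
    by apply: block_increasing_lift; left.
  by move=> _; rewrite perm_args_lift odd_lift_perm take0 drop0.
case: ifP => [an'|/negbT an'].
  rewrite -(right_part (Ordinal (an' : a.+1 < n.+1)%N)) //; apply: eq_bigl => s.
  case sa: (block_increasing a.+1 s) => //=; have [i si iE] := first_hit s sa.
  have s0 j : (s j == ord0) = (j == i) by rewrite -si (inj_eq perm_inj).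
  by rewrite !s0 -!val_eqE /=; case: iE => ->; rewrite ?eqxx.
rewrite big_pred0 // => s; case sa: (block_increasing a.+1 s) => //=.
have [i si iE] := first_hit s sa.
have s0 j : (s j == ord0) = (j == i) by rewrite -si (inj_eq perm_inj).
by rewrite s0 -val_eqE /=; have := ltn_ord i; case: iE => ->; lia.
Qed.
End Shuffles.

(** * Composition by contraction of the first argument *)

Section Insertion.
Variables (K : fieldType) (g : lmodType K).

Definition contract (X : g * g) (P : seq (g * g) -> g -> g) :
    seq (g * g) -> g -> g := fun L => P (X :: L).

(** The composition P o Q for Q of degree q.  The degree of P is left implicit:
    a P that vanishes on the lists of the wrong length makes the terms that
    contract it too often vanish. *)
Fixpoint insertion q (P Q : seq (g * g) -> g -> g) (L : seq (g * g)) (x : g) : g :=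
  if L is X :: L' then
    (-1) ^+ q *: insertion q (contract X P) Q L' x +
    (if q is q'.+1 then insertion q' P (contract X Q) L' x
     else P ((Q [::] X.1, X.2) :: L') x + P ((X.1, Q [::] X.2) :: L') x)
  else P [::] (Q [::] x).

Lemma insertion_cons q P Q X L x : insertion q P Q (X :: L) x =
  (-1) ^+ q *: insertion q (contract X P) Q L x +
  (if q is q'.+1 then insertion q' P (contract X Q) L x
   else P ((Q [::] X.1, X.2) :: L) x + P ((X.1, Q [::] X.2) :: L) x).
Proof. by []. Qed.

Lemma insertion0 q P Q L x : (forall L x, P L x = 0) -> insertion q P Q L x = 0.
Proof.
elim: L q P Q => [|X L IH] q P Q P0 /=; first exact: P0.
rewrite IH ?scaler0 ?add0r; last by move=> *; exact: P0.
by case: q => [|q]; [rewrite !P0 addr0 | exact: IH].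
Qed.

Definition signed_shuffle_sum a b F T : g :=
  (-1) ^+ (a * b) *: shuffle_sum (a + b) a F T.

Lemma signed_shuffle_sum_eq a b F F' T : (forall l r, F l r = F' l r) ->
  signed_shuffle_sum a b F T = signed_shuffle_sum a b F' T.
Proof.
by move=> FF'; congr (_ *: _); apply: eq_bigr => s _; rewrite FF'.
Qed.

Lemma signed_shuffle_sum_left a F X T :
  signed_shuffle_sum a.+1 0 F (X :: T) =
  signed_shuffle_sum a 0 (fun l => F (X :: l)) T.
Proof.
rewrite /signed_shuffle_sum !muln0 addSn shuffle_sum_cons ?addn0 //.
by rewrite ltnn addr0.
Qed.

Lemma signed_shuffle_sum_right b F X T :
  signed_shuffle_sum 0 b.+1 F (X :: T) =
  signed_shuffle_sum 0 b (fun l r => F l (X :: r)) T.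
Proof. by rewrite /signed_shuffle_sum shuffle_sum_cons // add0r !scale1r. Qed.

(** The factor (-1)^(a b) cancels the sign that depends on a in the second half
    and leaves on the first half a sign that depends only on b; hence all the
    summands of P o Q satisfy the same recursion. *)
Lemma signed_shuffle_sum_cons a b F X T :
  signed_shuffle_sum a.+1 b.+1 F (X :: T) =
  (-1) ^+ b.+1 *: signed_shuffle_sum a b.+1 (fun l => F (X :: l)) T +
  signed_shuffle_sum a.+1 b (fun l r => F l (X :: r)) T.
Proof.
rewrite /signed_shuffle_sum addSn shuffle_sum_cons; last by lia.
rewrite addnS ltnS leq_addr scalerDr !scalerA -!exprD mulSn; congr (_ + _ *: _).
by rewrite -signr_odd -[RHS]signr_odd; congr (_ ^+ (nat_of_bool _)); lia.
Qed.

Definition insert_slot k q (P Q : seq (g * g) -> g -> g) X x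
    (l r : seq (g * g)) : g :=
  P (l ++ (Q r (X`_(k + q)).1, (X`_(k + q)).2) :: drop (k + q).+1 X) x +
  P (l ++ ((X`_(k + q)).1, Q r (X`_(k + q)).2) :: drop (k + q).+1 X) x.

Definition seq_circ p q (P Q : seq (g * g) -> g -> g) X x : g :=
  \sum_(k < p) signed_shuffle_sum k q (insert_slot k q P Q X x) X +
  signed_shuffle_sum p q (fun l r => P l (Q r x)) X.

Lemma seq_circE p q P Q X x : size X = (p + q)%N ->
  (forall L x, size L != p -> P L x = 0) ->
  seq_circ p q P Q X x = insertion q P Q X x.
Proof.
elim: X p q P Q => [|X T IH] p q P Q /=.
  case: p => //; case: q => // _ _.
  by rewrite /seq_circ big_ord0 add0r /signed_shuffle_sum scale1r shuffle_sum0.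
have IHc p' q' : size T = (p' + q')%N -> (forall L x, size L != p'.+1 -> P L x = 0) ->
    insertion q' (contract X P) Q T x = seq_circ p' q' (contract X P) Q T x.
  by move=> sT P0; rewrite IH // => L y sL; apply: P0.
case: p => [|p]; case: q => [|q] // [sT] P0.
- rewrite insertion0 ?scaler0 ?add0r; last by move=> L y; apply: P0.
  by rewrite -(IH 0%N) // /seq_circ !big_ord0 !add0r signed_shuffle_sum_right.
- rewrite (IHc p) // scale1r /seq_circ big_ord_recl /=.
  rewrite {1}/signed_shuffle_sum scale1r shuffle_sum0 /insert_slot /= drop0.
  rewrite [RHS]addrC -addrA; congr (_ + (_ + _)); last by rewrite signed_shuffle_sum_left.
  by apply: eq_bigr => k _; rewrite signed_shuffle_sum_left.
rewrite (IHc p) // -(IH p.+1 q) //; last by rewrite sT addnS.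
rewrite /seq_circ signed_shuffle_sum_cons scalerDr !addrA; congr (_ + _).
rewrite [RHS]addrAC; congr (_ + _).
rewrite !big_ord_recl signed_shuffle_sum_right [RHS]addrCA; congr (_ + _).
rewrite scaler_sumr -big_split; apply: eq_bigr => k _ /=.
rewrite signed_shuffle_sum_cons; congr (_ + _).
apply: signed_shuffle_sum_eq => l r.
by rewrite /insert_slot /bump leq0n add1n !addSn addnS.
Qed.

Definition extend0 n (P : n.-tuple (g * g) -> g -> g) (L : seq (g * g)) (x : g) : g :=
  if size L == n then P [tuple L`_i | i < n] x else 0.

Lemma extend0_tuple n (P : n.-tuple (g * g) -> g -> g) (L : n.-tuple (g * g)) x :
  extend0 P L x = P L x.
Proof.
rewrite /extend0 size_tuple eqxx; congr (P _ x).
by apply: eq_from_tnth => i; rewrite tnth_mktuple -tnth_nth.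
Qed.

Lemma extend0_out n (P : n.-tuple (g * g) -> g -> g) L x :
  size L != n -> extend0 P L x = 0.
Proof. by rewrite /extend0 => /negPf ->. Qed.

Lemma circ_insertion p q (P : cochain g p) (Q : cochain g q) X x :
  size X = (p + q)%N ->
  circ P Q X x = insertion q (extend0 P) (extend0 Q) X x.
Proof.
move=> sX; rewrite -(seq_circE (p := p)) //; last exact: extend0_out.
rewrite circE /seq_circ /signed_shuffle_sum; congr (_ + _ *: _).
  apply: eq_bigr => k _; congr (_ *: _); rewrite /shuffle_sum.
  apply: eq_big => [s|s _]; first exact: is_shuffleE.
  have ins v : P (insert_args p s X v) x =
      extend0 P (left_args s X ++ v :: drop (k + q).+1 X) x.
    rewrite /extend0 size_cat size_tuple /= size_drop sX.
    by have := ltn_ord k; case: eqP => //; lia.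
  by rewrite /circ_term /insert_slot -left_argsE -right_argsE !ins !extend0_tuple.
apply: eq_big => [s|s _]; first exact: is_shuffleE.
by rewrite -left_argsE -right_argsE !extend0_tuple.
Qed.

End Insertion.

(** * The graded pre-Lie identity *)

Section PreLie.
Variables (K : fieldType) (g : lmodType K).
Implicit Types (P Q R : seq (g * g) -> g -> g) (L : seq (g * g)).

Lemma eq_sign m n : odd m = odd n -> (-1) ^+ m = (-1) ^+ n :> K.
Proof. by rewrite -signr_odd => ->; rewrite signr_odd. Qed.

Lemma subr_add3 (V : zmodType) (a b c a' b' c' : V) :
  a + b + c - (a' + b' + c') = (a - a') + (b - b') + (c - c').
Proof. by rewrite opprD addrACA; congr (_ + _); rewrite opprD addrACA. Qed.

Definition multilinear P : Prop :=
  [/\ forall L, linear (P L),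
      forall L L' v x, linear (fun u => P (L ++ (u, v) :: L') x)
    & forall L L' u x, linear (fun v => P (L ++ (u, v) :: L') x)].

Definition homogeneous q Q : Prop := forall L x, size L != q -> Q L x = 0.

Lemma multilinear_contract X P : multilinear P -> multilinear (contract X P).
Proof.
move=> [P1 P2 P3]; split=> [L|L L' v x|L L' u x]; first exact: P1.
  exact: (P2 (X :: L)).
exact: (P3 (X :: L)).
Qed.

Lemma homogeneous_contract X q Q :
  homogeneous q.+1 Q -> homogeneous q (contract X Q).
Proof. by move=> Q0 L x sL; apply: Q0. Qed.

Lemma insertion_linearl q a P P' Q L x :
  insertion q (fun M y => a *: P M y + P' M y) Q L x =
  a *: insertion q P Q L x + insertion q P' Q L x.
Proof.
elim: L q P P' Q => [|X L IH] q P P' Q //; rewrite !insertion_cons.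
rewrite [insertion q (contract _ _) Q L x](IH q (contract X P) (contract X P')).
rewrite !scalerDr scalerA mulrC -scalerA !addrA [RHS]addrAC -!addrA.
congr (_ + _); rewrite [RHS]addrA [RHS]addrC; congr (_ + _).
case: q => [|q]; last exact: IH.
by rewrite scalerDr -!addrA; congr (_ + _); rewrite addrCA.
Qed.

Lemma insertion_linearr q a P Q Q' L x : multilinear P ->
  insertion q P (fun M y => a *: Q M y + Q' M y) L x =
  a *: insertion q P Q L x + insertion q P Q' L x.
Proof.
elim: L q P Q Q' => [|X L IH] q P Q Q' Pm; first by case: Pm => P1 _ _; exact: P1.
rewrite !insertion_cons IH; last exact: multilinear_contract.
rewrite !scalerDr !scalerA [_ * a]mulrC -scalerA !addrA [RHS]addrAC -!addrA.
congr (_ + _); rewrite [RHS]addrA [RHS]addrC; congr (_ + _).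
case: q => [|q]; last exact: (IH q P (contract X Q) (contract X Q')).
case: Pm => _ P2 P3; rewrite (P2 [::]) (P3 [::]).
by rewrite scalerDr -!addrA; congr (_ + _); rewrite addrCA.
Qed.

Lemma insertionDr q P Q Q' L x : multilinear P ->
  insertion q P (fun M y => Q M y + Q' M y) L x =
  insertion q P Q L x + insertion q P Q' L x.
Proof.
move=> Pm; rewrite -[in RHS](scale1r (insertion q P Q L x)) -insertion_linearr //.
by congr (insertion q P _ L x); apply/funext => M; apply/funext => y; rewrite scale1r.
Qed.

Lemma insertionDl q P P' Q L x :
  insertion q (fun M y => P M y + P' M y) Q L x =
  insertion q P Q L x + insertion q P' Q L x.
Proof.
rewrite -[in RHS](scale1r (insertion q P Q L x)) -insertion_linearl.
by congr (insertion q _ Q L x); apply/funext => M; apply/funext => y; rewrite scale1r.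
Qed.

(** This is the recursion for P o Q under - o R, by linearity on the left; the
    next lemma does the same for Q o R under P o -. *)
Lemma insertion_contractl r q P Q R X L x :
  insertion r (contract X (insertion q P Q)) R L x =
  (-1) ^+ q *: insertion r (insertion q (contract X P) Q) R L x +
  (if q is q'.+1 then insertion r (insertion q' P (contract X Q)) R L x
   else insertion r (contract (Q [::] X.1, X.2) P) R L x +
        insertion r (contract (X.1, Q [::] X.2) P) R L x).
Proof.
case: q => [|q]; last exact: insertion_linearl.
rewrite -insertionDl; exact: insertion_linearl.
Qed.

Lemma insertion_contractr s r P Q R X L x : multilinear P ->
  insertion s P (contract X (insertion r Q R)) L x =
  (-1) ^+ r *: insertion s P (insertion r (contract X Q) R) L x +
  (if r is r'.+1 then insertion s P (insertion r' Q (contract X R)) L x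
   else insertion s P (contract (R [::] X.1, X.2) Q) L x +
        insertion s P (contract (X.1, R [::] X.2) Q) L x).
Proof.
move=> Pm; case: r => [|r]; last exact: insertion_linearr.
rewrite -insertionDr //; exact: insertion_linearr.
Qed.

Lemma insertion0r q P L x : multilinear P -> insertion q P (fun=> fun=> 0) L x = 0.
Proof.
move=> Pm; have E := insertion_linearr q (-1) (fun=> fun=> 0) (fun=> fun=> 0) L x Pm.
transitivity (insertion q P (fun=> fun=> (-1) *: 0 + 0) L x).
  by congr (insertion q P _ L x); do 2!apply/funext => ?; rewrite scaler0 addr0.
by rewrite E scaleN1r addNr.
Qed.

Definition associator q r P Q R L x : g :=
  insertion r (insertion q P Q) R L x -
  insertion (q + r)%N P (insertion r Q R) L x.

(** The contraction of an associator, according to the vanishing of q and r.  In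
    positive degrees contraction is a graded derivation of the associator; an
    argument of degree 0 acts on X itself and leaves extra terms. *)
Lemma associator_consSS q r P Q R X L x : multilinear P ->
  associator q.+1 r.+1 P Q R (X :: L) x =
  (-1) ^+ (q + r) *: associator q.+1 r.+1 (contract X P) Q R L x +
  (-1) ^+ r.+1 *: associator q r.+1 P (contract X Q) R L x +
  associator q.+1 r P Q (contract X R) L x.
Proof.
move=> Pm; rewrite /associator (insertion_cons r.+1) insertion_contractl.
rewrite addSn (insertion_cons (q + r.+1).+1) insertion_contractr //.
have -> : (-1) ^+ (q + r.+1).+1 = (-1) ^+ (q + r) :> K by apply: eq_sign; lia.
rewrite scalerDr scalerA -exprD addrA subr_add3 (addSnnS q r).
have -> : (-1) ^+ (r.+1 + q.+1) = (-1) ^+ (q + r) :> K by apply: eq_sign; lia.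
by rewrite -!scalerBr.
Qed.

Lemma subr_cancel2 (V : zmodType) (a b c1 d1 c2 d2 a' b' : V) :
  a + b + ((c1 + d1) + (c2 + d2)) - (a' + (b' + (d1 + d2))) =
  (a - a') + (b - b') + (c1 + c2).
Proof.
rewrite (addrACA c1) (addrA (a + b)) (addrA a') opprD (addrACA (a + b + _)).
by rewrite (subrr (d1 + d2)) addr0 addrAC opprD (addrACA a).
Qed.

Lemma subr_cancel_cross (V : zmodType) (a c e1 u1 v1 e2 u2 v2 b : V) :
  a + c + ((e1 + (u1 + v1)) + (e2 + (v2 + u2))) - (b + (u1 + u2)) =
  (a - b) + c + (e1 + e2) + (v2 + v1).
Proof.
have -> : (e1 + (u1 + v1)) + (e2 + (v2 + u2)) = (e1 + e2 + (v2 + v1)) + (u1 + u2).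
  by rewrite addrACA (addrC v2 u2) (addrACA u1) (addrC (u1 + u2)) addrA (addrC v1).
rewrite (addrA (a + c)) opprD (addrACA (a + c + (e1 + e2 + (v2 + v1)))).
by rewrite (subrr (u1 + u2)) addr0 addrAC (addrAC a) addrA.
Qed.

Lemma associator_consS0 q P Q R X L x : multilinear P ->
  associator q.+1 0 P Q R (X :: L) x =
  (-1) ^+ q.+1 *: associator q.+1 0 (contract X P) Q R L x +
  associator q 0 P (contract X Q) R L x +
  (-1) ^+ q.+1 *: (insertion q.+1 (contract (R [::] X.1, X.2) P) Q L x +
                   insertion q.+1 (contract (X.1, R [::] X.2) P) Q L x).
Proof.
move=> Pm; rewrite /associator (insertion_cons 0) insertion_contractl.
rewrite addSn (insertion_cons (q + 0).+1) insertion_contractr //.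
rewrite !insertion_cons !scale1r addn0.
by rewrite subr_cancel2 -scalerBr -scalerDr.
Qed.

Lemma associator_cons0S r P Q R X L x : multilinear P -> homogeneous 0 Q ->
  associator 0 r.+1 P Q R (X :: L) x =
  (-1) ^+ r.+1 *: associator 0 r.+1 (contract X P) Q R L x +
  associator 0 r P Q (contract X R) L x +
  (-1) ^+ r.+1 *: (insertion r.+1 (contract (Q [::] X.1, X.2) P) R L x +
                   insertion r.+1 (contract (X.1, Q [::] X.2) P) R L x).
Proof.
move=> Pm Q0; rewrite /associator !add0n !(insertion_cons r.+1) insertion_contractl.
rewrite insertion_contractr // scale1r.
(* The recursion for Q o R contracts Q, which has degree 0. *)
rewrite (_ : insertion r.+1 (contract X Q) R = fun=> fun=> 0); last first.
  apply/funext => M; apply/funext => y.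
  by rewrite insertion0 // => N z; apply: Q0.
rewrite insertion0r // scaler0 add0r (scalerDr ((-1) ^+ _)) (addrAC (_ *: _)).
by rewrite [LHS]addrAC; congr (_ + _); rewrite opprD addrACA -scalerBr.
Qed.

(** In degrees 0 and 0 the terms where both Q and R act on the same vector of X
    cancel, and those where they act on different vectors are symmetric. *)
Lemma associator_cons00 P Q R X L x : multilinear P ->
  associator 0 0 P Q R (X :: L) x =
  associator 0 0 (contract X P) Q R L x +
  (insertion 0 (contract (Q [::] X.1, X.2) P) R L x +
   insertion 0 (contract (X.1, Q [::] X.2) P) R L x) +
  (insertion 0 (contract (R [::] X.1, X.2) P) Q L x +
   insertion 0 (contract (X.1, R [::] X.2) P) Q L x) +
  (P ((Q [::] X.1, R [::] X.2) :: L) x + P ((R [::] X.1, Q [::] X.2) :: L) x).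
Proof.
move=> Pm; rewrite /associator (insertion_cons 0) insertion_contractl.
rewrite !insertion_cons !scale1r.
exact: subr_cancel_cross.
Qed.

(** The contraction formulas for the two sides agree term by term once the
    induction hypothesis is applied to the contracted associators. *)
Lemma associator_sym q r P Q R L x :
  multilinear P -> homogeneous q Q -> homogeneous r R ->
  associator q r P Q R L x = (-1) ^+ (q * r) *: associator r q P R Q L x.
Proof.
elim: L q r P Q R => [|X L IH] q r P Q R Pm Q0 R0.
  by rewrite /associator /= !subrr scaler0.
have Pm' := multilinear_contract X Pm.
case: q r Q0 R0 => [|q] [|r] Q0 R0.
- rewrite scale1r !associator_cons00 // (IH 0%N 0%N) // scale1r.
  by rewrite [X in _ = X + _]addrAC; congr (_ + _ + _ + _); rewrite addrC.
- rewrite scale1r associator_cons0S // associator_consS0 //.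
  by rewrite (IH 0%N) // (IH 0%N r) ?scale1r //; exact: homogeneous_contract.
- rewrite muln0 scale1r associator_cons0S // associator_consS0 //.
  rewrite (IH q.+1) // (IH q) // ?muln0 ?scale1r //; exact: homogeneous_contract.
rewrite !associator_consSS // (IH q.+1 r.+1) // (IH q) ?(IH q.+1 r) //;
  try exact: homogeneous_contract.
rewrite [RHS]scalerDr [X in _ = X + _]scalerDr !scalerA -!exprD [RHS]addrAC; congr (_ + _ + _);
  congr (_ *: _); apply: eq_sign; lia.
Qed.
End PreLie.

(** * The graded Jacobi identity *)

Section Jacobi.
Variables (K : fieldType) (g : lmodType K).
Implicit Types (P Q R : seq (g * g) -> g -> g) (L : seq (g * g)).

Lemma insertion_homogeneous p q P Q : multilinear P ->
  homogeneous p P -> homogeneous q Q -> homogeneous (p + q)%N (insertion q P Q).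
Proof.
move=> Pm P0 Q0 L; elim: L p q P Q Pm P0 Q0 => [|X L IH] p q P Q Pm P0 Q0 x.
  case: p P0 => [|p] P0 sL /=; last exact: P0.
  by rewrite Q0 //; case: Pm => P1 _ _; exact: linear_fun0.
have Pm' := multilinear_contract X Pm.
rewrite insertion_cons /= => sL; rewrite [X in _ *: X](_ : _ = 0); last first.
  case: p P0 sL => [|p] P0 sL; first by apply: insertion0 => M y; apply: P0.
  by apply: (IH p) => //; exact: homogeneous_contract.
rewrite scaler0 add0r; case: q Q0 sL => [|q] Q0; last first.
  by rewrite addnS eqSS => sL; apply: (IH p) => //; exact: homogeneous_contract.
by rewrite addn0 => sL; rewrite !P0 ?addr0.
Qed.

Definition seq_bracket (p q : nat) P Q L x : g :=
  insertion q P Q L x - (-1) ^+ (p * q) *: insertion p Q P L x.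

Lemma insertion_bracketl s p q P Q R L x :
  insertion s (seq_bracket p q P Q) R L x =
  insertion s (insertion q P Q) R L x -
  (-1) ^+ (p * q) *: insertion s (insertion p Q P) R L x.
Proof.
rewrite /seq_bracket addrC -scaleNr -insertion_linearl.
by congr (insertion s _ R L x); do 2!apply/funext => ?; rewrite scaleNr addrC.
Qed.

(** The graded pre-Lie identity in the form used for the Jacobi identity:
    P |-> P o Q is a graded representation of the bracket, on the right. *)
Lemma insertion_bracketr q r P Q R L x :
  multilinear P -> homogeneous q Q -> homogeneous r R ->
  insertion (q + r)%N P (seq_bracket q r Q R) L x =
  insertion r (insertion q P Q) R L x -
  (-1) ^+ (q * r) *: insertion q (insertion r P R) Q L x.
Proof.
move=> Pm Q0 R0; have := associator_sym L x Pm Q0 R0; rewrite /associator scalerBr.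
move/eqP; rewrite subr_eq => /eqP ->.
transitivity (insertion (q + r)%N P (fun M y => - (-1) ^+ (q * r) *: insertion q R Q M y
   + insertion r Q R M y) L x).
  by congr (insertion _ _ _ L x); do 2!apply/funext => ?; rewrite scaleNr addrC.
rewrite insertion_linearr // scaleNr (addnC r q).
by rewrite -[X in _ = X - _]addrA [X in _ = X - _]addrC addrK.
Qed.

(** The Jacobi identity with x, y, z the signs (-1)^(pq), (-1)^(pr), (-1)^(qr)
    and a, ..., f the six composites (P o Q) o R, (P o R) o Q, (Q o R) o P,
    (R o Q) o P, (Q o P) o R, (R o P) o Q. *)
Lemma jacobi_regroup (V : lmodType K) (x y z : K) (a b c d e f : V) :
  x * x = 1 ->
  a - z *: b - (x * y) *: (c - z *: d) =
  (a - x *: e - (y * z) *: (f - x *: d)) +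
  x *: (e - y *: c - (x * z) *: (b - y *: f)).
Proof.
move=> xx; rewrite !scalerBr !scalerA !mulrA xx !mul1r.
rewrite (mulrC (y * z) x) mulrA (mulrC z y) !opprB [RHS]addrACA subrKA subrKA.
by rewrite addrAC [RHS]addrA addrA (addrAC a).
Qed.

Lemma seq_jacobi p q r P Q R L x :
  multilinear P -> multilinear Q -> multilinear R ->
  homogeneous p P -> homogeneous q Q -> homogeneous r R ->
  seq_bracket p (q + r)%N P (seq_bracket q r Q R) L x =
  seq_bracket (p + q)%N r (seq_bracket p q P Q) R L x +
  (-1) ^+ (p * q) *: seq_bracket q (p + r)%N Q (seq_bracket p r P R) L x.
Proof.
move=> Pm Qm Rm P0 Q0 R0; rewrite {1 3 5}/seq_bracket.
rewrite !insertion_bracketr // !insertion_bracketl.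
rewrite !mulnDr !mulnDl !exprD (mulnC q p).
by apply: jacobi_regroup; rewrite -expr2 sqrr_sign.
Qed.

End Jacobi.

Section GradedLieAlgebra.
Variables (K : fieldType) (g : lmodType K).

Lemma mktuple_nth n (L : seq (g * g)) : size L = n -> [tuple L`_i | i < n] = L :> seq _.
Proof.
move=> sL; apply: (@eq_from_nth _ 0); rewrite size_tuple // => i ilt.
have /= <- := tnth_nth 0 [tuple L`_i | i < n] (Ordinal ilt).
by rewrite tnth_mktuple.
Qed.

Lemma extend0_multilinear n (P : cochain g n) : multilinear (extend0 P).
Proof.
have [P1 P2 P3] := cochainP P.
have slot (L L' : seq (g * g)) x : size (L ++ 0 :: L') = n ->
    exists X : n.-tuple (g * g), exists i : 'I_n,
    forall v, extend0 P (L ++ v :: L') x = P (upd X i v) x.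
  move=> sL; have iL : (size L < n)%N by rewrite -sL size_cat /= -addSnnS leq_addr.
  exists [tuple (L ++ 0 :: L')`_i | i < n], (Ordinal iL) => v.
  rewrite -extend0_tuple; congr (extend0 P _ x).
  apply: (@eq_from_nth _ 0); first by rewrite size_tuple -sL !size_cat.
  move=> j; rewrite size_cat /= addnS => jL; rewrite nth_upd; last first.
    by rewrite -sL size_cat /= addnS.
  rewrite mktuple_nth // !nth_cat /=; case: ltngtP => // [jl|->].
    by case: (j - size L)%N (subn_gt0 (size L) j) => //; rewrite jl.
  by rewrite subnn.
split=> [L a u v|L L' v x|L L' u x].
- rewrite /extend0; case: ifP => _; first exact: P2.
  by rewrite scaler0 addr0.
- have [sL|sL] := eqVneq (size (L ++ 0 :: L')) n; last first.
    move=> a u w; rewrite !extend0_out ?scaler0 ?addr0 //; move: sL; rewrite !size_cat //.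
  have [X [i E]] := slot L L' x sL; have [l _ _] := P1 X i x.
  by move=> a u w; rewrite !E l.
- have [sL|sL] := eqVneq (size (L ++ 0 :: L')) n; last first.
    move=> a v w; rewrite !extend0_out ?scaler0 ?addr0 //; move: sL; rewrite !size_cat //.
  have [X [i E]] := slot L L' x sL; have [_ l _] := P1 X i x.
  by move=> a v w; rewrite !E l.
Qed.

Lemma extend0_homogeneous n (P : cochain g n) : homogeneous n (extend0 P).
Proof. by move=> L x; exact: extend0_out. Qed.

Lemma extend0_inj n (P Q : cochain g n) :
  (forall L x, extend0 P L x = extend0 Q L x) -> P = Q.
Proof.
move=> PQ; apply: val_inj; apply/funext => X; apply/funext => x /=.
by rewrite -!extend0_tuple PQ.
Qed.

Lemma extend0_gcast m n (e : m = n) (P : cochain g m) L x :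
  extend0 (gcast (V := cochain g) e P) L x = extend0 P L x.
Proof. by case: _ / e. Qed.

Lemma extend0_linear n a (P Q : cochain g n) L x :
  extend0 (a *: P + Q) L x = a *: extend0 P L x + extend0 Q L x.
Proof. by rewrite /extend0; case: ifP => _ //; rewrite scaler0 addr0. Qed.

Lemma extend0D n (P Q : cochain g n) L x :
  extend0 (P + Q) L x = extend0 P L x + extend0 Q L x.
Proof. by rewrite -{1}[P]scale1r extend0_linear scale1r. Qed.

Lemma extend0_0 n L x : extend0 (0 : cochain g n) L x = 0.
Proof. by rewrite /extend0; case: ifP. Qed.

Lemma extend0Z n a (P : cochain g n) L x :
  extend0 (a *: P) L x = a *: extend0 P L x.
Proof. by rewrite -[a *: P]addr0 extend0_linear extend0_0 addr0. Qed.

Lemma extend0_bracket p q (P : cochain g p) (Q : cochain g q) L x :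
  extend0 (bracket P Q) L x = seq_bracket p q (extend0 P) (extend0 Q) L x.
Proof.
have PH := extend0_homogeneous P; have QH := extend0_homogeneous Q.
rewrite {1}/extend0 /seq_bracket; case: eqP => [sL|/eqP sL] /=; last first.
  rewrite (insertion_homogeneous (extend0_multilinear P) PH QH) // (insertion_homogeneous (extend0_multilinear Q) QH PH) 1?addnC //.
  by rewrite scaler0 subr0.
rewrite /bracket_fun !circ_insertion ?size_tuple ?(addnC q) //.
by rewrite !mktuple_nth.
Qed.

Lemma bracket_linearl p q (Q : cochain g q) : linear (fun P : cochain g p => bracket P Q).
Proof.
move=> a P P'; apply: extend0_inj => L x.
rewrite extend0_linear !extend0_bracket /seq_bracket.
have -> : extend0 (a *: P + P') = fun M y => a *: extend0 P M y + extend0 P' M y.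
  by do 2!apply/funext => ?; exact: extend0_linear.
rewrite insertion_linearl insertion_linearr; last exact: extend0_multilinear.
by rewrite scalerBr scalerDr opprD addrACA !scalerA (mulrC a).
Qed.

Lemma bracket_antisym p q (P : cochain g p) (Q : cochain g q) :
  bracket P Q = - ((-1) ^+ (p * q)) *: gcast (V := cochain g) (addnC q p) (bracket Q P).
Proof.
apply: extend0_inj => L x.
rewrite extend0Z extend0_gcast !extend0_bracket /seq_bracket (mulnC q p).
by rewrite scalerBr scalerA mulNr -expr2 sqrr_sign !scaleNr scale1r opprK addrC.
Qed.

Lemma bracket_linearr p q (P : cochain g p) : linear (fun Q : cochain g q => bracket P Q).
Proof.
move=> a Q Q'; apply: extend0_inj => L x; rewrite extend0_linear.
rewrite !(bracket_antisym P) !extend0Z !extend0_gcast.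
rewrite (bracket_linearl (q := p) P a Q Q') extend0_linear scalerDr.
by rewrite !scalerA (mulrC a).
Qed.

Lemma bracket_jacobi p q r (P : cochain g p) (Q : cochain g q) (R : cochain g r) :
  bracket P (bracket Q R) =
  gcast (V := cochain g) (esym (addnA p q r)) (bracket (bracket P Q) R) +
  (-1) ^+ (p * q) *: gcast (V := cochain g) (addnCA q p r) (bracket Q (bracket P R)).
Proof.
apply: extend0_inj => L x; rewrite extend0D extend0Z !extend0_gcast.
have brE m n (A : cochain g m) (B : cochain g n) :
    extend0 (bracket A B) = seq_bracket m n (extend0 A) (extend0 B).
  by do 2!apply/funext => ?; exact: extend0_bracket.
rewrite !brE; apply: seq_jacobi;
  by [exact: extend0_multilinear | exact: extend0_homogeneous].
Qed.

Theorem bracket_graded_Lie : is_graded_Lie (V := cochain g) (@bracket K g).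
Proof.
split.
- by move=> p q Q; exact: bracket_linearl.
- by move=> p q P; exact: bracket_linearr.
- exact: bracket_antisym.
- exact: bracket_jacobi.
Qed.

End GradedLieAlgebra.

(** * Compatible 3-Lie structures and Maurer-Cartan elements *)

Section MaurerCartan.
Variables (K : fieldType) (g : lmodType K).
Implicit Types b c : cochain g 1.

Lemma extend0_op3 b X x : extend0 b [:: X] x = op3 b X.1 X.2 x.
Proof. by rewrite (extend0_tuple b [tuple X]) /op3 -surjective_pairing. Qed.

Lemma insertion_op3 b c x1 x2 x3 x4 x5 :
  insertion 1 (extend0 b) (extend0 c) [:: (x1, x2); (x3, x4)] x5 =
  op3 b (op3 c x1 x2 x3) x4 x5 + op3 b x3 (op3 c x1 x2 x4) x5 +
  op3 b x3 x4 (op3 c x1 x2 x5) - op3 b x1 x2 (op3 c x3 x4 x5).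
Proof.
rewrite /= /contract !extend0_op3 /= [extend0 b [:: _; _]  _]extend0_out //.
by rewrite scaler0 !add0r expr1 expr0 scale1r scaleN1r addrC [X in X - _]addrC.
Qed.

Lemma bracket_op3 b c x1 x2 x3 x4 x5 :
  extend0 (bracket b c) [:: (x1, x2); (x3, x4)] x5 =
  insertion 1 (extend0 b) (extend0 c) [:: (x1, x2); (x3, x4)] x5 +
  insertion 1 (extend0 c) (extend0 b) [:: (x1, x2); (x3, x4)] x5.
Proof. by rewrite extend0_bracket /seq_bracket expr1 scaleN1r opprK. Qed.

Lemma bracket11_eq0 b c : bracket b c = 0 <->
  (forall x1 x2 x3 x4 x5,
     extend0 (bracket b c) [:: (x1, x2); (x3, x4)] x5 = 0).
Proof.
split=> [-> *|bc0]; first exact: extend0_0.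
apply: extend0_inj => L x; rewrite extend0_0.
case: L => [|[x1 x2] [|[x3 x4] [|X L]]]; by [exact: extend0_out | exact: bc0].
Qed.

Lemma bracket_eq0_compatible b c : bracket b c = 0 <->
  (forall x1 x2 x3 x4 x5,
     op3 b x1 x2 (op3 c x3 x4 x5) + op3 c x1 x2 (op3 b x3 x4 x5) =
     op3 b (op3 c x1 x2 x3) x4 x5 + op3 c (op3 b x1 x2 x3) x4 x5 +
     op3 b x3 (op3 c x1 x2 x4) x5 + op3 c x3 (op3 b x1 x2 x4) x5 +
     op3 b x3 x4 (op3 c x1 x2 x5) + op3 c x3 x4 (op3 b x1 x2 x5)).
Proof.
have regroup (u v a a' d d' e e' : g) :
    (a + d + e - u) + (a' + d' + e' - v) = a + a' + d + d' + e + e' - (u + v).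
  rewrite addrACA -opprD; congr (_ - _).
  by rewrite (addrACA (a + d)) (addrACA a) !addrA.
rewrite bracket11_eq0; split=> bc x1 x2 x3 x4 x5.
  have := bc x1 x2 x3 x4 x5; rewrite bracket_op3 !insertion_op3 regroup.
  by move/eqP; rewrite subr_eq0 => /eqP <-.
by rewrite bracket_op3 !insertion_op3 regroup bc; apply/eqP; rewrite subr_eq0.
Qed.

Lemma bracketDl p q (P P' : cochain g p) (Q : cochain g q) :
  bracket (P + P') Q = bracket P Q + bracket P' Q.
Proof. by have := bracket_linearl Q 1 P P'; rewrite !scale1r. Qed.

Lemma bracketDr p q (P : cochain g p) (Q Q' : cochain g q) :
  bracket P (Q + Q') = bracket P Q + bracket P Q'.
Proof. by have := bracket_linearr P 1 Q Q'; rewrite !scale1r. Qed.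

Lemma bracket0l p q (Q : cochain g q) : bracket (0 : cochain g p) Q = 0.
Proof. by apply: (addIr (bracket 0 Q)); rewrite -bracketDl !add0r. Qed.

Hypothesis two_neq0 : 2%:R != 0 :> K.

Lemma double_eq0 (V : lmodType K) (v : V) : v + v = 0 -> v = 0.
Proof.
by move/eqP; rewrite -mulr2n -scaler_nat scaler_eq0 (negPf two_neq0) => /eqP.
Qed.

Lemma bracket_eq0_fundamental b : bracket b b = 0 <-> fundamental_identity (op3 b).
Proof.
rewrite bracket11_eq0; split=> bb x1 x2 x3 x4 x5.
  have := bb x1 x2 x3 x4 x5; rewrite bracket_op3 insertion_op3 => /double_eq0.
  by move/eqP; rewrite subr_eq0 => /eqP <-.
by rewrite bracket_op3 insertion_op3 (bb x1 x2 x3 x4 x5) subrr addr0.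
Qed.

Lemma is_3Lie_op3 b : is_3Lie (op3 b) <-> bracket b b = 0.
Proof.
rewrite bracket_eq0_fundamental; split=> [[]//|fb].
by split; [exact: op3_trilinear | exact: op3_skew | ].
Qed.

Lemma is_compatible_op3 b c : is_compatible_3Lie (op3 b) (op3 c) <->
  [/\ bracket b b = 0, bracket c c = 0 & bracket b c = 0].
Proof.
split=> [[/is_3Lie_op3 bb /is_3Lie_op3 cc /bracket_eq0_compatible bc] //|].
by move=> [/is_3Lie_op3 bb /is_3Lie_op3 cc /bracket_eq0_compatible bc].
Qed.

Lemma bracket11C b c : bracket b c = bracket c b.
Proof.
apply: extend0_inj => L x; rewrite !extend0_bracket /seq_bracket !expr1.
by rewrite !scaleN1r !opprK addrC.
Qed.

(** By the Jacobi identity, d_b d_c + d_c d_b = d_[b, c]. *)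
Lemma differentials_anticommute b c n (P : cochain g n) : bracket b c = 0 ->
  differential b (differential c P) + differential c (differential b P) = 0.
Proof.
move=> bc; apply: extend0_inj => L x; rewrite extend0D extend0_0.
have -> : extend0 (differential b (differential c P)) L x =
    - extend0 (differential c (differential b P)) L x.
  have := bracket_jacobi b c P; rewrite bc => /(congr1 (fun F : cochain g _ => extend0 F L x)).
  rewrite extend0D extend0Z !extend0_gcast expr1 scaleN1r.
  by rewrite bracket0l extend0_0 add0r.
by rewrite addNr.
Qed.

Lemma differential_dgLie b : bracket b b = 0 ->
  is_dgLie (V := cochain g) (@bracket K g) (@differential K g b).
Proof.
move=> bb; split.
- exact: bracket_graded_Lie.
- by move=> n a P Q; exact: (bracket_linearr b a P Q).
- by move=> n P; apply: double_eq0; exact: differentials_anticommute.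
move=> p q P Q; apply: extend0_inj => L x.
rewrite extend0D extend0Z extend0_gcast.
have := bracket_jacobi b P Q => /(congr1 (fun F : cochain g _ => extend0 F L x)).
by rewrite extend0D extend0Z !extend0_gcast mul1n.
Qed.

Lemma bracket_shift b c t u : bracket b c = 0 ->
  bracket (b + t) (c + u) = differential b u + differential c t + bracket t u.
Proof.
move=> bc; rewrite /differential (bracket11C c t).
by rewrite bracketDl !bracketDr bc add0r addrA.
Qed.

(** As [b, b] = 0 and [b, t] = [t, b] in degree 1, the bracket on the left is
    twice the Maurer-Cartan expression on the right. *)
Lemma bracket_self_shift b t : bracket b b = 0 ->
  bracket (b + t) (b + t) = 0 <->
  differential b t + 2%:R^-1 *: bracket t t = 0.
Proof.
move=> bb; rewrite bracket_shift //.
have -> : differential b t + differential b t + bracket t t =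
    2%:R *: (differential b t + 2%:R^-1 *: bracket t t).
  by rewrite scalerDr scalerA mulfV // scale1r scaler_nat mulr2n.
split=> [/eqP|->]; last exact: scaler0.
by rewrite scaler_eq0 (negPf two_neq0) => /eqP.
Qed.

End MaurerCartan.

Theorem theorem2p11 (K : closedFieldType) (charK : [pchar K] =i pred0)
    (g : vectType K) (pi1 pi2 : cochain g 1) :
  is_compatible_3Lie (op3 pi1) (op3 pi2) ->
  is_bidgLie (V := cochain g) (@bracket K g)
    (@differential K g pi1) (@differential K g pi2) /\
  forall tpi1 tpi2 : cochain g 1,
    is_compatible_3Lie (op3 (pi1 + tpi1)) (op3 (pi2 + tpi2)) <->
    is_Maurer_Cartan (V := cochain g) (@bracket K g)
      (@differential K g pi1) (@differential K g pi2) tpi1 tpi2.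
Proof.
have two : 2%:R != 0 :> K.
  by have := charK 2; rewrite !inE /= => /negbT.
move/(is_compatible_op3 two) => [b11 b22 b12]; split.
  split; [exact: differential_dgLie | exact: differential_dgLie |].
  by move=> n P; exact: differentials_anticommute.
move=> t1 t2.
have e1 := bracket_self_shift two t1 b11; have e2 := bracket_self_shift two t2 b22.
have e12 := bracket_shift t1 t2 b12.
split=> [/(is_compatible_op3 two)[/e1 c1 /e2 c2 c12]|[/e1 c1 /e2 c2 c12]].
  by split=> //; rewrite -e12.
by apply/(is_compatible_op3 two); split; rewrite // e12.
Qed.
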